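(* Let $Q\in\mathcal B$. Then the function $(0,1)\ni\beta\mapsto\mathcal H^{\beta,0}(\Lambda,\phi_0)(Q)$ is left differentiable, and $$\begin{aligned}\left.\frac{d_-}{d_-\beta}\mathcal H^{\beta,0}(\Lambda,\phi_0)(Q)\right|_{\beta=\alpha}&=\Xi^{\alpha,\alpha}_1(Q)=\lim_{\beta\to^-\alpha}\Xi^{\alpha,\beta}_1(Q)=\lim_{\beta\to^-\alpha}\Xi^{\beta,\beta}_1(Q)\\&=\lim_{\beta\to^-\alpha}\Psi^{\alpha,\beta}_{1,\delta_\tau(\beta,\alpha)}(Q)=\lim_{\beta\to^-\alpha}\Psi^{\beta,\beta}_{1,\delta_\tau(\beta,\alpha)}(Q)\\&=\lim_{\beta\to^-\alpha}\Psi^{\alpha,\beta}_1(Q)=\lim_{\beta\to^-\alpha}\Psi^{\beta,\beta}_1(Q)\end{aligned}$$ for all $0<\alpha<1$ and $\tau>1$, where $d_-/d_-\beta$ denotes the left derivative. From the right, for every $0<\alpha_0<1$ and $\tau>0$, $$\lim_{\alpha\to^+\alpha_0}\Xi^{\alpha,\alpha}_{1,\epsilon'_\tau(\alpha_0,\alpha)}(Q)=\lim_{\alpha\to^+\alpha_0}\Xi^{\alpha_0,\alpha}_{1,\epsilon'_\tau(\alpha_0,\alpha)}(Q)=\Xi^{\alpha_0,\alpha_0}_1(Q),$$ and, for every $0<\alpha_0<1$ and $\tau>1$, $$\lim_{\alpha\to^+\alpha_0}\Xi^{\alpha,\alpha}_{1,\delta_\tau(\alpha_0,\alpha)}(Q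)=\lim_{\alpha\to^+\alpha_0}\Xi^{\alpha_0,\alpha}_{1,\delta_\tau(\alpha_0,\alpha)}(Q)=\lim_{\alpha\to^+\alpha_0}\Xi^{\alpha,\alpha}_1(Q)=\lim_{\alpha\to^+\alpha_0}\Xi^{\alpha_0,\alpha}_1(Q)=\Psi^{\alpha_0,\alpha_0}_1(Q).$$
   Context: Setting. Let $X$ be a set, $S:X\to X$ a bijection, $\mathcal A$ a $\sigma$-algebra on $X$, $\mathcal A_0$ the $\sigma$-algebra generated by $\bigcup_{i\ge 0}S^{-i}\mathcal A$, $\mathcal B$ the $\sigma$-algebra generated by $\bigcup_{i\in\mathbb Z}S^{-i}\mathcal A$, and $\mathcal A_m:=S^{-m}\mathcal A_0=\{S^{-m}A:A\in\mathcal A_0\}$ for integers $m\le 0$ (so $\mathcal A_0\subset\mathcal A_{-1}\subset\cdots$). Let $\phi_0$ be a finite positive measure on $\mathcal A_0$, and $\Lambda$ a finite positive measure on $\mathcal A_0$ with $\Lambda\circ S^{-1}=\Lambda$ and $\Lambda\ll\phi_0$; let $Z\ge0$ be an $\mathcal A_0$-measurable version of $d\Lambda/d\phi_0$. For $Q\subset X$ let $\mathcal C(Q)$ be the set of all sequences $(A_m)_{m\le0}$ with $A_m\in\mathcal A_m$ for all $m\le 0$ and $Q\subset\bigcup_{m\le0}A_m$. Define $\Phi(Q):=\inf_{(A_m)\in\mathcal C(Q)}\sum_{m\le0}\phi_0(S^mA_m)$. The symbol $\Lambda$ also denotes $\Lambda(Q):=\inf_{(A_m)\in\mathcal C(Q)}\sum_{m\le0}\Lambda(S^mA_m)$,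 $Q\subset X$; its restriction to $\mathcal B$ is the unique $S$-invariant measure on $\mathcal B$ extending $\Lambda$. Conventions: extended real numbers are used, $0\log0:=0$, $y^x:=e^{x\log y}$ and thus $0^0:=1$; $Z^\alpha\log Z:=0$ where $Z=0$ ($\alpha>0$). $x\to^-y$ ($x\to^+y$) means $x\to y$ with $x<y$ ($x>y$). For $\epsilon>0$ and $\alpha\in[0,1]$: $\mathcal C^0_\epsilon(Q):=\{(A_m)\in\mathcal C(Q):\sum_{m\le0}\phi_0(S^mA_m)<\Phi(Q)+\epsilon\}$; $\mathcal H^{\alpha,0}_\epsilon(\Lambda,\phi_0)(Q):=\inf_{(A_m)\in\mathcal C^0_\epsilon(Q)}\sum_{m\le0}\int_{S^mA_m}Z^\alpha d\phi_0$; $\mathcal H^{\alpha,0}(\Lambda,\phi_0)(Q):=\lim_{\epsilon\to0}\mathcal H^{\alpha,0}_\epsilon(\Lambda,\phi_0)(Q)$, which is a finite $S$-invariant measure on $\mathcal B$. For $Q\in\mathcal B$: $\mathcal C^{\alpha}_{1,\epsilon}(Q):=\{(A_m)\in\mathcal C^0_\epsilon(Q):\sum_{m\le0}\int_{S^mA_m}Z^\alpha d\phi_0<\mathcal H^{\alpha,0}(\Lambda,\phi_0)(Q)+\epsilon\}$; for $0<\alpha\le1$, $0\le\beta\le1$: $\Psi^{\alpha,\beta}_{1,\epsilon}(Q):=\inf_{(A_m)\in\mathcal C^{\beta}_{1,\epsilon}(Q)}\sum_{m\le0}\int_{S^mA_m}Z^\alpha\log Z\,d\phi_0$, $\Psi^{\alpha,\beta}_1(Q):=\lim_{\epsilon\to0}\Psi^{\alpha,\beta}_{1,\epsilon}(Q)$.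 Let $\mathcal C^1_\epsilon(Q):=\{(A_m)\in\mathcal C(Q):\sum_{m\le0}\Lambda(S^mA_m)<\Lambda(Q)+\epsilon\}$; $\mathcal C^{0,1}_\epsilon(Q):=\{(A_m)\in\mathcal C^1_\epsilon(Q):\sum_{m\le0}\phi_0(S^mA_m)<\Phi^{\Lambda}(Q)+\epsilon\}$, where $\Phi^{\Lambda}(Q):=\lim_{\epsilon\to0}\inf_{(A_m)\in\mathcal C^1_\epsilon(Q)}\sum_{m\le0}\phi_0(S^mA_m)$ (which equals $\Phi(Q)$); for $0\le\beta\le1$, $\mathcal H^{\beta,0,1}(\Lambda,\phi_0)(Q):=\lim_{\epsilon\to0}\inf_{(A_m)\in\mathcal C^{0,1}_\epsilon(Q)}\sum_{m\le0}\int_{S^mA_m}Z^\beta d\phi_0$ and $\mathcal C^{\beta,0,1}_\epsilon(Q):=\{(A_m)\in\mathcal C^{0,1}_\epsilon(Q):\sum_{m\le0}\int_{S^mA_m}Z^\beta d\phi_0<\mathcal H^{\beta,0,1}(\Lambda,\phi_0)(Q)+\epsilon\}$. For $0<\alpha\le1$, $0\le\beta\le1$: $\Xi^{\alpha,\beta}_{1,\epsilon}(Q):=\sup_{(A_m)\in\mathcal C^{\beta,0,1}_\epsilon(Q)}\sum_{m\le0}\int_{S^mA_m}Z^\alpha\log Z\,d\phi_0$ and $\Xi^{\alpha,\beta}_1(Q):=\lim_{\epsilon\to0}\Xi^{\alpha,\beta}_{1,\epsilon}(Q)$. For $\tau>0$ and $\alpha_1,\alpha_2\in[0,1]$ (with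 $Q$ fixed): $\delta_\tau(\alpha_1,\alpha_2):=|\alpha_1-\alpha_2|^{\tau/2}\sup\{0<\delta<|\alpha_1-\alpha_2|^{\tau/2}:\ \mathcal H^{\alpha_i,0}_\delta(\Lambda,\phi_0)(Q)>\mathcal H^{\alpha_i,0}(\Lambda,\phi_0)(Q)-|\alpha_1-\alpha_2|^\tau\text{ for }i=1,2\}$. For $0<\alpha_0\le\alpha<1$: $\epsilon'_\tau(\alpha_0,\alpha):=(\alpha-\alpha_0)\big(\Xi^{\alpha,\alpha_0}_{1,\delta_\tau(\alpha_0,\alpha)}(Q)-\Xi^{\alpha_0,\alpha}_{1,\delta_\tau(\alpha_0,\alpha)}(Q)\big)+2(\alpha-\alpha_0)^\tau+3\delta_\tau(\alpha_0,\alpha)$. *)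

(* Defs.v *)
From HB Require Import structures.
From mathcomp Require Import all_boot all_order all_algebra.
From mathcomp Require Import all_classical all_reals all_analysis.
From mathcomp Require Import measurable_realfun.
Set Implicit Arguments.
Unset Strict Implicit.
Unset Printing Implicit Defensive.
Import Order.TTheory GRing.Theory Num.Theory.
Import numFieldNormedType.Exports.
Local Open Scope classical_set_scope.
Local Open Scope ring_scope.
Local Open Scope ereal_scope.

(* The given sigma-algebra on X is the one carried by X : measurableType d.
   The time m <= 0 is encoded by the natural number n = - m throughout.  For
   the bijection S, S^m A is then the preimage of A under [iter n S], and
   S^{-m} A is its image. *)

Definition gen_A0 d (X : measurableType d) (S : X -> X) : set (set X) :=
  \bigcup_(i in [set: nat]) [set iter i S @^-1` A | A in measurable].

Notation A0 S := (g_sigma_algebraType (gen_A0 S)).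

(* S^{-i} A for i : int (Negz n is the integer - n.+1) *)
Definition pull d (X : measurableType d) (S : X -> X) (i : int) (A : set X) :
    set X :=
  match i with
  | Posz n => iter n S @^-1` A
  | Negz n => iter n.+1 S @` A
  end.

Definition gen_B d (X : measurableType d) (S : X -> X) : set (set X) :=
  \bigcup_(i in [set: int]) [set pull S i A | A in measurable].

Definition sigma_B d (X : measurableType d) (S : X -> X) : set (set X) :=
  <<s gen_B S >>.

Definition sigma_Am d (X : measurableType d) (S : X -> X) (n : nat) :
    set (set X) :=
  [set iter n S @` A | A in (measurable : set (set (A0 S)))].

Definition covers d (X : measurableType d) (S : X -> X) (Q : set X) :
    set ((set X)^nat) :=
  [set A | (forall n, sigma_Am S n (A n)) /\ Q `<=` \bigcup_n A n].

(* \sum_{m <= 0} mu (S^m A_m) *)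
Definition cover_sum d (X : measurableType d) (R : realType) (S : X -> X)
    (mu : set X -> \bar R) (A : (set X)^nat) : \bar R :=
  \sum_(n <oo) mu (iter n S @^-1` A n).

Definition outer d (X : measurableType d) (R : realType) (S : X -> X)
    (mu : set X -> \bar R) (Q : set X) : \bar R :=
  ereal_inf [set cover_sum S mu A | A in covers S Q].

Section derivation.
Context d (X : measurableType d) (R : realType) (S : X -> X)
  (phi0 Lambda : {finite_measure set (A0 S) -> \bar R}) (Z : A0 S -> \bar R)
  (Q : set X).
Implicit Types (a b eps tau : R).

(* Z may take the value +oo (on a phi0-null set).  With the library's
   conventions 0 `^ 0 = 1 and (0 `^ a) * lne 0 = 0 * -oo = 0 for a > 0. *)
Definition pow_int a (B : set X) : \bar R :=
  \int[phi0]_(x in (B : set (A0 S))) (Z x `^ a).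

Definition powlog_int a (B : set X) : \bar R :=
  \int[phi0]_(x in (B : set (A0 S))) ((Z x `^ a) * lne (Z x)).

Definition C0 eps : set ((set X)^nat) :=
  [set A | covers S Q A /\
           cover_sum S phi0 A < outer S phi0 Q + eps%:E].

Definition H_eps a eps : \bar R :=
  ereal_inf [set cover_sum S (pow_int a) A | A in C0 eps].

Definition H a : \bar R := lim (H_eps a eps @[eps --> 0^'+]).

(* phi0-minimizing covers that also minimize the integrals of Z `^ a *)
Definition C0H a eps : set ((set X)^nat) :=
  [set A | C0 eps A /\ cover_sum S (pow_int a) A < H a + eps%:E].

Definition Psi_eps a b eps : \bar R :=
  ereal_inf [set cover_sum S (powlog_int a) A | A in C0H b eps].

Definition Psi a b : \bar R := lim (Psi_eps a b eps @[eps --> 0^'+]).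

Definition C1 eps : set ((set X)^nat) :=
  [set A | covers S Q A /\
           cover_sum S Lambda A < outer S Lambda Q + eps%:E].

Definition PhiLambda : \bar R :=
  lim (ereal_inf [set cover_sum S phi0 A | A in C1 eps] @[eps --> 0^'+]).

Definition C01 eps : set ((set X)^nat) :=
  [set A | C1 eps A /\ cover_sum S phi0 A < PhiLambda + eps%:E].

Definition H01 b : \bar R :=
  lim (ereal_inf [set cover_sum S (pow_int b) A | A in C01 eps]
       @[eps --> 0^'+]).

Definition Cb01 b eps : set ((set X)^nat) :=
  [set A | C01 eps A /\ cover_sum S (pow_int b) A < H01 b + eps%:E].

Definition Xi_eps a b eps : \bar R :=
  ereal_sup [set cover_sum S (powlog_int a) A | A in Cb01 b eps].

Definition Xi a b : \bar R := lim (Xi_eps a b eps @[eps --> 0^'+]).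

Definition delta tau a1 a2 : R :=
  (`|a1 - a2| `^ (tau / 2) *
   sup [set e : R | (0 < e < `|a1 - a2| `^ (tau / 2))%R /\
     forall a, a \in [:: a1; a2] ->
       (H a - (`|a1 - a2| `^ tau)%:E < H_eps a e)%E])%R.

(* For 0 < a0 < a < 1 both values of Xi_eps below are finite, so that [fine]
   only changes the type. *)
Definition eps' tau a0 a : R :=
  ((a - a0) * fine (Xi_eps a a0 (delta tau a0 a) - Xi_eps a0 a (delta tau a0 a))
   + 2 * (a - a0) `^ tau + 3 * delta tau a0 a)%R.

End derivation.

Definition left_quotient (R : realType) (f : R -> \bar R) (a b : R) : \bar R :=
  (f b - f a) * ((b - a)^-1)%:E.

(* Convergence to the real number l forces f to be finite at a and on some
   interval to the left of a. *)
Definition left_derivable (R : realType) (f : R -> \bar R) (a : R) : Prop :=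
  exists l : R, left_quotient f a b @[b --> a^'-] --> l%:E.

Definition left_derivative (R : realType) (f : R -> \bar R) (a : R) : \bar R :=
  lim (left_quotient f a b @[b --> a^'-]).

(* Main.v *)
(** Write a cover as (B_n) with B_n in A0 and Q contained in the union of the
    S^n B_n.  For every finite measure psi on A0 the outer sum over covers is
    additive on B (Carathéodory), and it is additive in the pair (psi, Lambda)
    when Lambda is invariant.  Applied to psi = phi0 + s Z^b phi0 with s small,
    this yields covers that are nearly optimal for Lambda, for phi0 and for the
    integrals of Z^b at once; hence Phi^Lambda = Phi and H^(b,0,1) = H^(b,0).

    For a fixed cover the sum h_a of the integrals of Z^a is convex in a, and
    its derivative l_a, the sum of the integrals of Z^a log Z, is Lipschitz in a
    uniformly over the covers of bounded Lambda-sum.  For b < a and up to errors,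
    l_b(A) <= (H_a - H_b) / (a - b) if A is nearly optimal for a, and
    l_a(A) >= (H_a - H_b) / (a - b) if A is nearly optimal for b.  As nearly
    optimal covers for b are nearly optimal for a when b is close to a, the
    quotients converge from the left to the limit of the suprema of l_a, and
    from the right to the limit of the infima. *)

(* Two obstacles shape the argument. First, psi is not invariant, and A0 is stable under preimages
   but not under images, so a piece can be re-indexed only to a later time. Disjoint covers cope
   with this: pulled back to one common late time, their pieces become disjoint sets of A0, while
   outer psi-sums only grow under preimages.

   Second, the Lipschitz bound needs control of the sum of the integrals of 1 + Z, that is, of the
   phi0-sum and the Lambda-sum. The covers that define Xi have it, those that define H and Psi need
   not; making a cover disjoint restores it and raises no sum of integrals of a nonnegative
   function. The exponents stay in an interval [l, u] inside ]0, 1[, because t^2 e^(xt) is bounded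
   by a multiple of 1 + e^t, uniformly in x, only away from 0 and 1.

   With the level delta, the error in the sums h_a is |a - b|^tau; for tau > 1 it disappears from
   the difference quotient. For eps' any tau > 0 is enough: there eps' only has to tend to 0 and to
   be large enough for nearly optimal covers to remain nearly optimal at the next exponent. *)
Require Import Defs.
From HB Require Import structures.
From mathcomp Require Import all_boot all_order all_algebra.
From mathcomp Require Import all_classical all_reals all_analysis.
From mathcomp Require Import measurable_realfun.
From mathcomp Require Import zify ring lra.
Set Implicit Arguments.
Unset Strict Implicit.
Unset Printing Implicit Defensive.
Import Order.TTheory GRing.Theory Num.Theory.
Import numFieldNormedType.Exports.
Local Open Scope classical_set_scope.
Local Open Scope ring_scope.
Local Open Scope ereal_scope.

(** * Outer sums over covers *)

Section covers.
Context (d : measure_display) (X : measurableType d) (S : X -> X).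
Hypothesis bijS : bijective S.
Implicit Types (A B : (set X)^nat) (F Q : set X).

Definition A0_measurable F := measurable (F : set (A0 S)).

Definition base_cover Q : set ((set X)^nat) :=
  [set B | (forall n, A0_measurable (B n)) /\ Q `<=` \bigcup_n iter n S @` B n].

Lemma preimage_iterD m n F :
  iter m S @^-1` (iter n S @^-1` F) = iter (m + n) S @^-1` F.
Proof. by rewrite addnC; apply/seteqP; split => x /=; rewrite iterD. Qed.

Lemma iter_inj n : injective (iter n S).
Proof. by elim: n => // n IH x y /= /(bij_inj bijS)/IH. Qed.

Lemma iter_surj n x : exists y, iter n S y = x.
Proof.
case: bijS => g _ gK; elim: n x => [x|n IH x]; first by exists x.
by have [y gy] := IH (g x); exists y; rewrite /= gy gK.
Qed.

Lemma preimage_iterK n F : iter n S @^-1` (iter n S @` F) = F.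
Proof.
apply/seteqP; split => [x [y Fy /iter_inj <-]//|x Fx].
by exists x.
Qed.

Lemma image_iterK n F : iter n S @` (iter n S @^-1` F) = F.
Proof.
apply/seteqP; split => [x [y Fy <-]//|x Fx].
by have [y yx] := iter_surj n x; exists y => //=; rewrite yx.
Qed.

(** Pulling a generator back raises its index by one. *)
Lemma A0_preimage n F : A0_measurable F -> A0_measurable (iter n S @^-1` F).
Proof.
have mS : measurable_fun [set: A0 S] (S : A0 S -> A0 S).
  refine (@measurability _ _ (A0 S) (A0 S) setT S (gen_A0 S) _ _) => //.
  move=> _ [_ [i _ [A mA <-]] <-]; apply: sub_sigma_algebra.
  exists i.+1 => //; exists A => //.
  by rewrite setTI; apply/seteqP; split => x /=; rewrite -iterSr.
elim: n F => // n IH F mF.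
rewrite -[n.+1]addn1 -preimage_iterD; apply: IH.
by have := mS measurableT _ mF; rewrite setTI.
Qed.

Definition shift_cover A := (fun n => iter n S @^-1` A n).

Lemma covers_base_cover Q A : covers S Q A -> base_cover Q (shift_cover A).
Proof.
move=> [mA QA]; split=> [n|x /QA [n _ Anx]].
  by rewrite /shift_cover; case: (mA n) => B mB <-; rewrite preimage_iterK.
by exists n => //; rewrite /shift_cover image_iterK.
Qed.

Definition unshift_cover B := (fun n => iter n S @` B n).

Lemma unshift_coverK : cancel unshift_cover shift_cover.
Proof. by move=> B; apply/funext => n; exact: preimage_iterK. Qed.

Lemma base_cover_covers Q B : base_cover Q B -> covers S Q (unshift_cover B).
Proof. by move=> [mB QB]; split => // n; exists (B n) => //; exact: mB. Qed.

Context (R : realType).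
Implicit Types (mu : set X -> \bar R) (psi : {measure set (A0 S) -> \bar R}).

Lemma cover_sum_unshift mu B :
  cover_sum S mu (unshift_cover B) = \sum_(n <oo) mu (B n).
Proof.
by rewrite /cover_sum -[X in _ = \sum_(n <oo) mu (X n)](unshift_coverK B).
Qed.

Lemma outer_le mu Q B : base_cover Q B -> outer S mu Q <= \sum_(n <oo) mu (B n).
Proof.
move=> QB; apply: ereal_inf_lbound; exists (unshift_cover B).
  exact: base_cover_covers.
exact: cover_sum_unshift.
Qed.

Lemma outer_ge mu Q x :
  (forall B, base_cover Q B -> x <= \sum_(n <oo) mu (B n)) -> x <= outer S mu Q.
Proof.
move=> xle; apply: le_ereal_inf_tmp => _ [A /covers_base_cover QA <-].
exact: xle QA.
Qed.

Lemma outer_ge0 mu Q : (forall F, 0 <= mu F) -> 0 <= outer S mu Q.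
Proof. by move=> mu0; apply: outer_ge => B _; apply: nneseries_ge0. Qed.

Lemma outer_subset mu Q Q' : Q `<=` Q' -> outer S mu Q <= outer S mu Q'.
Proof.
move=> QQ'; apply: outer_ge => B [mB Q'B]; apply: outer_le.
by split => //; exact: subset_trans Q'B.
Qed.

Lemma outer_leT psi Q : outer S psi Q <= psi setT.
Proof.
apply: (@le_trans _ _ (\sum_(n <oo) psi (if n is 0 then setT else set0))).
  apply: outer_le; split => [[|n]|x _].
  - exact: measurableT.
  - exact: measurable0.
  - by exists 0%N => //; exists x.
rewrite nneseries_recl//.
by rewrite eseries0 ?adde0// => -[//|n] _ _; exact: measure0.
Qed.

Lemma outer_set0 psi : outer S psi set0 = 0.
Proof.
apply/eqP; rewrite eq_le outer_ge0// andbT.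
apply: (@le_trans _ _ (\sum_(n <oo) psi set0)).
  by apply: outer_le; split => [n|x//]; exact: measurable0.
by rewrite eseries0// => *; exact: measure0.
Qed.

(** The piece B_n is cut along S^{-n} F, which is in A0 because F is; for a set S^k F this may fail
    while n < k. *)
Lemma outer_splitI psi Q F : A0_measurable F ->
  outer S psi (Q `&` F) + outer S psi (Q `&` ~` F) <= outer S psi Q.
Proof.
move=> mF; apply: outer_ge => B [mB QB].
have mI n : A0_measurable (B n `&` iter n S @^-1` F).
  by apply: measurableI; [exact: mB|exact: A0_preimage].
have mD n : A0_measurable (B n `\` iter n S @^-1` F).
  by apply: measurableD; [exact: mB|exact: A0_preimage].
have -> : \sum_(n <oo) psi (B n) = \sum_(n <oo) psi (B n `&` iter n S @^-1` F) +
    \sum_(n <oo) psi (B n `\` iter n S @^-1` F).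
  rewrite -nneseriesD//; apply: eq_eseriesr => n _.
  rewrite -measureU; first by rewrite -setIUr setUv setIT.
  - exact: mI.
  - exact: mD.
  - by apply/seteqP; split => x // -[[_ ?] [_]].
apply: leeD; apply: outer_le; split => // x [/QB[n _ [y By <-]] Fx];
  by exists n => //; exists y.
Qed.

(** A cover of S^{-1} Q, delayed by one step behind an empty piece at time 0, covers Q with the same
    sum. *)
Lemma outer_preimage psi n Q : outer S psi Q <= outer S psi (iter n S @^-1` Q).
Proof.
elim: n Q => [|n IH] Q; first exact: outer_subset.
rewrite -add1n -preimage_iterD; apply: (le_trans _ (_ : outer S psi (iter n S @^-1` Q) <= _)).
  exact: IH.
apply: outer_ge => B [mB QB].
rewrite (_ : \sum_(k <oo) psi (B k) =
    \sum_(k <oo) psi (if k is k'.+1 then B k' else set0)); last first.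
  rewrite [RHS]nneseries_recl// measure0 add0e -(@nneseries_addn _ _ 1%N)//.
  by apply: eq_eseriesr => k _; rewrite addn1.
apply: outer_le; split => [[|k]|x Qx]; [exact: measurable0|exact: mB|].
have [y yx] := iter_surj 1 x.
have /QB[k _ [z Bz zy]] : (iter 1 S @^-1` (iter n S @^-1` Q)) y by rewrite /preimage /= -yx in Qx *.
by exists k.+1 => //; exists z => //=; rewrite zy -yx.
Qed.

Lemma outer_bigcup psi (Q : (set X)^nat) :
  outer S psi (\bigcup_n Q n) <= \sum_(n <oo) outer S psi (Q n).
Proof.
apply/lee_addgt0Pr => _/posnumP[e].
rewrite (le_trans _ (epsilon_trick _ _ _))//; last first.
  by move=> n; exact: outer_ge0.
have [[n Qoo]|Qfin] := pselect (exists n, outer S psi (Q n) = +oo).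
  rewrite (@nneseries_pinfty _ _ _ n) ?leey// => [k _|].
    by rewrite adde_ge0// ?outer_ge0.
  by rewrite Qoo.
have /choice[B hB] n : exists B, base_cover (Q n) B /\
    \sum_(k <oo) psi (B k) <= outer S psi (Q n) + (e%:num / (2 ^ n.+1)%:R)%:E.
  have fin : outer S psi (Q n) \is a fin_num.
    rewrite ge0_fin_numE ?outer_ge0// ltey; apply/eqP => h.
    by apply: Qfin; exists n.
  have e0 : (0 < e%:num / (2 ^ n.+1)%:R)%R by [].
  have [_ [A /covers_base_cover cA <-] lA] := lb_ereal_inf_adherent e0 fin.
  by exists (shift_cover A); split => //; exact: ltW.
(* The covers are merged time by time. *)
apply: (@le_trans _ _ (\sum_(k <oo) psi (\bigcup_n B n k))).
  apply: outer_le; split => [k|x [n _ Qx]].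
    by apply: (@bigcupT_measurable _ (A0 S)) => n; have [[mB _] _] := hB n; exact: mB.
  have [[_ /(_ x Qx)[k _ [y By yx]]] _] := hB n.
  by exists k => //; exists y => //; exists n.
apply: (@le_trans _ _ (\sum_(k <oo) \sum_(n <oo) psi (B n k))).
  apply: lee_nneseries => // k _.
  apply: (measure_sigma_subadditive psi) => //.
    by move=> n; have [[mB _] _] := hB n; exact: mB.
  by apply: (@bigcupT_measurable _ (A0 S)) => n; have [[mB _] _] := hB n; exact: mB.
rewrite nneseries_interchange//; apply: lee_nneseries => [n _ _|n _].
  exact: nneseries_ge0.
by case: (hB n).
Qed.

Section outer_measure.
Variable psi : {measure set (A0 S) -> \bar R}.

HB.instance Definition _ := isOuterMeasure.Build R X (outer S psi)
  (outer_set0 psi) (fun Q => outer_ge0 Q (measure_ge0 psi))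
  (fun Q Q' => @outer_subset psi Q Q') (outer_bigcup psi).

Lemma outerU Q Q' : outer S psi (Q `|` Q') <= outer S psi Q + outer S psi Q'.
Proof. exact: outer_measureU2. Qed.

End outer_measure.

(* The limit of [outer] along time shifts: unlike [outer], it splits along every
   set of the form [S^n F] with F in A0, which makes Carathéodory's theorem
   applicable. *)
Definition outer_lim psi Q := ereal_sup [set outer S psi (iter n S @^-1` Q) | n in setT].

Section caratheodory.
Variable psi : {measure set (A0 S) -> \bar R}.

Let lim0 : outer_lim psi set0 = 0.
Proof.
rewrite /outer_lim (_ : [set _ | _ in _] = [set 0]) ?ereal_sup1//.
apply/seteqP; split => [_ [n _ <-]|_ ->] /=.
  by rewrite preimage_set0 outer_set0.
by exists 0%N => //; rewrite preimage_set0 outer_set0.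
Qed.

Let lim_ge n Q : outer S psi (iter n S @^-1` Q) <= outer_lim psi Q.
Proof. by apply: ereal_sup_ubound; exists n. Qed.

Let lim_ge0 Q : 0 <= outer_lim psi Q.
Proof. by apply: le_trans (lim_ge 0%N Q); exact: outer_ge0. Qed.

Let lim_subset : {homo outer_lim psi : A B / A `<=` B >-> A <= B}.
Proof.
move=> A B AB; apply: ge_ereal_sup => _ [n _ <-].
by apply: le_trans (lim_ge n B); apply: outer_subset => x /= /AB.
Qed.

Let lim_sigma : sigma_subadditive (outer_lim psi).
Proof.
move=> F; apply: ge_ereal_sup => _ [n _ <-].
rewrite preimage_bigcup; apply: le_trans (outer_bigcup _ _) _.
by apply: lee_nneseries => k *; [exact: outer_ge0|exact: lim_ge].
Qed.

HB.instance Definition _ := isOuterMeasure.Build R X (outer_lim psi)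
  lim0 lim_ge0 lim_subset lim_sigma.

(** Pulled back by n + k steps, S^k F becomes S^{-n} F, a set of A0, along which [outer] splits. The
    two suprema can be taken separately because [outer] grows under preimages. *)
Lemma outer_lim_caratheodory k F : A0_measurable F ->
  caratheodory_measurable (outer_lim psi) (iter k S @` F).
Proof.
move=> mF; apply: le_caratheodory_measurable => Q.
have mono m n Q' : (m <= n)%N ->
    outer S psi (iter m S @^-1` Q') <= outer S psi (iter n S @^-1` Q').
  by move=> /subnK <-; rewrite -preimage_iterD outer_preimage.
have split2 n : outer S psi (iter n S @^-1` (Q `&` iter k S @` F)) +
    outer S psi (iter n S @^-1` (Q `&` ~` (iter k S @` F))) <= outer_lim psi Q.
  apply: le_trans (lim_ge (n + k)%N Q).
  have eF : iter (n + k) S @^-1` (iter k S @` F) = iter n S @^-1` F.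
    by rewrite -preimage_iterD preimage_iterK.
  have eI : iter (n + k) S @^-1` (Q `&` iter k S @` F) =
      iter (n + k) S @^-1` Q `&` iter n S @^-1` F by rewrite -eF.
  have eC : iter (n + k) S @^-1` (Q `&` ~` (iter k S @` F)) =
      iter (n + k) S @^-1` Q `&` ~` (iter n S @^-1` F) by rewrite -eF.
  apply: le_trans (leeD (mono _ (n + k)%N _ _) (mono _ (n + k)%N _ _)) _;
    rewrite ?leq_addr// eI eC.
  by apply: outer_splitI; exact: A0_preimage.
change (outer_lim psi (Q `&` iter k S @` F) +
  outer_lim psi (Q `&` ~` (iter k S @` F)) <= outer_lim psi Q).
have [bo|bfin] := eqVneq (outer_lim psi Q) +oo; first by rewrite bo leey.
have fin x : 0 <= x -> x <= outer_lim psi Q -> x \is a fin_num.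
  by move=> x0 /le_lt_trans xQ; rewrite ge0_fin_numE// xQ// ltey.
have finQ n Q' : Q' `<=` Q -> outer S psi (iter n S @^-1` Q') \is a fin_num.
  move=> Q'Q; apply: fin; first exact: outer_ge0.
  by apply: le_trans (lim_ge n _) _; exact: lim_subset.
rewrite -leeBrDl ?fin//; last by apply: lim_subset.
apply: ge_ereal_sup => _ [n _ <-].
rewrite leeBrDl ?fin//; last by apply: lim_subset.
rewrite -leeBrDr ?finQ//.
apply: ge_ereal_sup => _ [m _ <-]; rewrite leeBrDr ?finQ//.
apply: le_trans (split2 (maxn m n)); apply: leeD; apply: mono.
  exact: leq_maxl.
exact: leq_maxr.
Qed.

(** The sets of B are Carathéodory-measurable for [outer_lim]. The test set is the whole space: it
    is invariant, so [outer_lim] and [outer] agree there, and on the two parts [outer] is at most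
    [outer_lim]. *)
Lemma outer_setC Q : sigma_B S Q ->
  outer S psi Q + outer S psi (~` Q) <= outer S psi setT.
Proof.
move=> BQ.
have cQ : caratheodory_measurable (outer_lim psi) Q.
  apply: BQ; split.
    split.
    - exact: caratheodory_measurable_set0.
    - by move=> A /caratheodory_measurable_setC; rewrite setTD.
    - exact: caratheodory_measurable_bigcup.
  move=> _ [[n|n] _ [A mA <-]] /=.
    (* S^{-n} A already lies in A0 and is taken at shift 0. *)
    rewrite -[_ @^-1` _](image_iterK 0); apply: outer_lim_caratheodory => /=.
    by apply: sub_sigma_algebra; exists n => //; exists A.
  rewrite -[_ @` A]/(iter n.+1 S @` A); apply: outer_lim_caratheodory => /=.
  by apply: sub_sigma_algebra; exists 0%N => //; exists A.
have <- : outer_lim psi setT = outer S psi setT.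
  rewrite /outer_lim (_ : [set _ | _ in _] = [set outer S psi setT]) ?ereal_sup1//.
  apply/seteqP; split => [_ [n _ <-]|_ ->] /=; first by rewrite preimage_setT.
  by exists 0%N => //; rewrite preimage_setT.
rewrite (cQ setT) !setTI.
by apply: leeD; [exact: (lim_ge 0%N Q)|exact: (lim_ge 0%N (~` Q))].
Qed.

End caratheodory.

End covers.

(** * Disjoint covers and invariant measures *)

Section disjoint_covers.
Context (d : measure_display) (X : measurableType d) (S : X -> X).
Hypothesis bijS : bijective S.
Context (R : realType).
Implicit Types (B : (set X)^nat) (F Q : set X).

Local Notation A0_measurable := (A0_measurable S).

(** For A_n = S^n B_n this is A_n minus the earlier A_k, pulled back by S^n: the point S^n x lies in
    S^k B_k exactly when S^(n - k) x lies in B_k. Only preimages occur, so the pieces stay in A0. *)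
Definition disjointify B : (set X)^nat :=
  fun n => B n `\` \bigcup_(k in `I_n) iter (n - k) S @^-1` B k.

Lemma disjointify_sub B n : disjointify B n `<=` B n.
Proof. by move=> x []. Qed.

Lemma disjointify_measurable B : (forall n, A0_measurable (B n)) ->
  forall n, A0_measurable (disjointify B n).
Proof.
move=> mB n; apply: measurableD; first exact: mB.
by apply: (@bigcup_measurable _ (A0 S)) => k _; apply: A0_preimage; exact: mB.
Qed.

Lemma disjointify_cover Q B : base_cover S Q B -> base_cover S Q (disjointify B).
Proof.
move=> [mB QB]; split=> [|x /QB[n0 _ Bx]]; first exact: disjointify_measurable.
have exn : exists n, `[< (iter n S @` B n) x >] by exists n0; exact/asboolP.
case: (ex_minnP exn) => n /asboolP[z Bz zx] nmin.
exists n => //; exists z => //; split => // -[k kn Bk].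
have : (n <= k)%N.
  apply: nmin; apply/asboolP; exists (iter (n - k) S z) => //.
  by rewrite -iterD subnKC ?(ltnW kn).
by rewrite leqNgt kn.
Qed.

(** The disjoint sets S^n D_n may lie outside A0; this is their version at a common time N, where
    they belong to A0. *)
Lemma disjointify_preimage_disjoint B N j k : (j < k)%N -> (k <= N)%N ->
  (iter (N - j) S @^-1` disjointify B j) `&`
  (iter (N - k) S @^-1` disjointify B k) = set0.
Proof.
move=> jk kN; apply/seteqP; split => // x [[Bj _] [_]]; apply.
exists j => //=; rewrite -iterD.
by have -> : (k - j + (N - k) = N - j)%N by lia.
Qed.

(** The set function is only assumed superadditive along A0, because it will be [outer S psi] as
    well as Lambda. *)
Lemma sum_disjoint_le (nu : set X -> \bar R) N (F : (set X)^nat) Q :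
    (forall Q' F', A0_measurable Q' -> A0_measurable F' ->
      nu (Q' `&` F') + nu (Q' `&` ~` F') <= nu Q') ->
    (forall Q', 0 <= nu Q') ->
    A0_measurable Q ->
    (forall k, (k < N)%N -> A0_measurable (F k) /\ F k `<=` Q) ->
    (forall j k, (j < k)%N -> (k < N)%N -> F j `&` F k = set0) ->
  \sum_(0 <= k < N) nu (F k) <= nu Q.
Proof.
move=> nuD nu0; elim: N Q => [|N IH] Q mQ mF dF; first by rewrite big_geq.
have [mFN FNQ] := mF N (leqnn _).
rewrite big_nat_recr//=; apply: le_trans (nuD _ _ mQ mFN).
rewrite (setIidr FNQ) addeC leeD2l//; apply: IH => [|k kN|j k jk kN].
- by apply: measurableI => //; exact: measurableC.
- have [mFk FkQ] := mF k (ltnW kN); split => // x Fx; split; first exact: FkQ.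
  move=> FNx; suff : set0 x by [].
  by rewrite -(dF k N).
- by apply: dF => //; exact: ltnW.
Qed.

Section sum.
Variable Lambda : {measure set (A0 S) -> \bar R}.
Hypothesis Lambda_inv : forall A : set (A0 S), measurable A ->
  Lambda (S @^-1` A) = Lambda A.

Lemma Lambda_preimage n F : A0_measurable F -> Lambda (iter n S @^-1` F) = Lambda F.
Proof.
move=> mF; elim: n => // n IH.
rewrite -[RHS]IH -[RHS]Lambda_inv; last exact: A0_preimage.
by congr (Lambda _); apply/seteqP; split => x; rewrite /preimage /= -iterSr.
Qed.

(** The hypothesis on B says that S^n B_n lies in F. At the common time N the pieces are disjoint
    subsets of S^{-N} F, and by invariance neither they nor F have changed their mass. *)
Lemma sum_disjointify_le B F : (forall n, A0_measurable (B n)) ->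
  A0_measurable F -> (forall n, B n `<=` iter n S @^-1` F) ->
  \sum_(n <oo) Lambda (disjointify B n) <= Lambda F.
Proof.
move=> mB mF BF; have mD := disjointify_measurable mB.
apply: lime_le; first by apply: is_cvg_nneseries.
apply: nearW => N; rewrite -(Lambda_preimage N mF).
rewrite (eq_big_nat _ _ (F2 := fun n => Lambda (iter (N - n) S @^-1` disjointify B n))).
  apply: sum_disjoint_le => [Q' F' mQ mF'|Q'||k kN|j k jk kN].
  - rewrite -measureU//.
    + by rewrite -setIUr setUv setIT.
    + exact: measurableI.
    + by apply: measurableI => //; exact: measurableC.
    + by rewrite setIACA setICr setI0.
  - exact: measure_ge0.
  - exact: A0_preimage.
  - split; first exact: A0_preimage.
    move=> x /disjointify_sub /BF; rewrite /preimage /= -iterD subnKC//.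
    exact: ltnW.
  - by apply: disjointify_preimage_disjoint => //; exact: ltnW.
by move=> n _; rewrite Lambda_preimage.
Qed.

Variable psi : {measure set (A0 S) -> \bar R}.
Hypothesis psi_fin : psi setT < +oo.
Hypothesis Lambda_fin : Lambda setT < +oo.

Lemma measure_fin_num (mu : {measure set (A0 S) -> \bar R}) F :
  mu setT < +oo -> A0_measurable F -> mu F \is a fin_num.
Proof.
move=> muT mF; rewrite ge0_fin_numE ?measure_ge0//; apply: le_lt_trans muT.
by apply: le_measure => //; rewrite inE.
Qed.

Lemma outer_fin_num (mu : {measure set (A0 S) -> \bar R}) Q :
  mu setT < +oo -> outer S mu Q \is a fin_num.
Proof.
move=> muT; rewrite ge0_fin_numE ?outer_ge0//; apply: le_lt_trans muT.
by apply: le_trans (outer_leT bijS mu setT); exact: outer_subset.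
Qed.

Let psiL : {measure set (A0 S) -> \bar R} := measure_add psi Lambda.

(** A psi-cover of F is cut down to F and made disjoint: the psi-sum does not increase, and the
    Lambda-sum drops to at most Lambda F. *)
Lemma outer_measure_add_A0 F : A0_measurable F ->
  outer S psiL F <= outer S psi F + Lambda F.
Proof.
move=> mF; have Lf := measure_fin_num Lambda_fin mF.
rewrite -leeBlDr//; apply: outer_ge => // B [mB FB]; rewrite leeBlDr//.
pose C n := B n `&` iter n S @^-1` F.
have cC : base_cover S F C.
  split=> [n|x Fx]; first by apply: measurableI; [exact: mB|exact: A0_preimage].
  by have [n _ [y By yx]] := FB x Fx; exists n => //; exists y => //; split => //=; rewrite yx.
have mC := disjointify_measurable cC.1.
apply: le_trans (outer_le bijS _ (disjointify_cover cC)) _.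
rewrite (eq_eseriesr (g := fun n => psi (disjointify C n) + Lambda (disjointify C n))); last first.
  by move=> n _; exact: measure_addE.
rewrite nneseriesD//; apply: leeD.
  apply: lee_nneseries => // n _; apply: le_measure; rewrite ?inE//.
  - exact: mC.
  - exact: mB.
  - by move=> x /disjointify_sub[].
by apply: sum_disjointify_le => // n; [exact: cC.1|exact: subIsetr].
Qed.

(** Monotonicity under preimages replaces the invariance that psi lacks: at time N the pieces are
    disjoint sets of A0, along which [outer] splits. *)
Lemma sum_outer_disjointify B : (forall n, A0_measurable (B n)) ->
  \sum_(n <oo) outer S psi (disjointify B n) <= outer S psi setT.
Proof.
move=> mB; have mD := disjointify_measurable mB.
apply: lime_le; first by apply: is_cvg_nneseries => *; exact: outer_ge0.
apply: nearW => N.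
apply: (@le_trans _ _ (\sum_(0 <= n < N) outer S psi (iter (N - n) S @^-1` disjointify B n))).
  by apply: lee_sum => n _; exact: outer_preimage.
apply: sum_disjoint_le => [Q' F' mQ mF'|Q'||k kN|j k jk kN].
- exact: outer_splitI.
- exact: outer_ge0.
- exact: measurableT.
- by split => //; exact: A0_preimage.
- by apply: disjointify_preimage_disjoint => //; exact: ltnW.
Qed.

(* Take a disjoint Lambda-optimal cover of X and cover each of its pieces
   psi-optimally by disjoint subsets of the piece at later times: by invariance
   this does not increase the Lambda-sum. *)
Lemma outer_measure_addT : outer S psiL setT <= outer S psi setT + outer S Lambda setT.
Proof.
have pf := outer_fin_num setT psi_fin.
rewrite addeC -leeBlDr//; apply: outer_ge => // B cB; rewrite leeBlDr// addeC.
have [mB' cB'] := disjointify_cover cB.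
apply: (@le_trans _ _ (\sum_(n <oo) outer S psiL (iter n S @` disjointify B n))).
  by apply: le_trans (outer_bigcup bijS _ _); exact: outer_subset.
apply: (@le_trans _ _ (\sum_(n <oo)
    (outer S psi (disjointify B n) + Lambda (disjointify B n)))).
  apply: lee_nneseries => [n _ _|n _]; first exact: outer_ge0.
  apply: le_trans (outer_preimage bijS _ n _) _; rewrite preimage_iterK//.
  exact: outer_measure_add_A0.
rewrite nneseriesD//; last by move=> *; exact: outer_ge0.
apply: leeD; first exact: sum_outer_disjointify cB.1.
apply: lee_nneseries => // n _; apply: le_measure; rewrite ?inE//.
- exact: mB'.
- exact: cB.1.
- exact: disjointify_sub.
Qed.

(* The outer sums are additive on B and superadditive in the measure, so equality
   on X forces equality on each set of B. *)
Lemma outer_measure_add Q : sigma_B S Q ->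
  outer S psiL Q <= outer S psi Q + outer S Lambda Q.
Proof.
move=> BQ.
have psiLfin : psiL setT < +oo.
  by rewrite [X in X < _](measure_addE psi Lambda) lte_add_pinfty.
have pf Q' := outer_fin_num Q' psi_fin.
have Lf Q' := outer_fin_num Q' Lambda_fin.
have pLf Q' : outer S psiL Q' \is a fin_num by exact: outer_fin_num.
have lower Q' : outer S psi Q' + outer S Lambda Q' <= outer S psiL Q'.
  apply: outer_ge => // B cB.
  rewrite (eq_eseriesr (g := fun n => psi (B n) + Lambda (B n))); last first.
    by move=> n _; exact: measure_addE.
  by rewrite nneseriesD//; apply: leeD; exact: outer_le.
have := outer_measure_addT.
have := outer_setC bijS psiL BQ.
have := outerU bijS psi Q (~` Q); have := outerU bijS Lambda Q (~` Q).
rewrite setUv; move: (lower (~` Q)).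
rewrite -(fineK (pf Q)) -(fineK (pf (~` Q))) -(fineK (pf setT)).
rewrite -(fineK (Lf Q)) -(fineK (Lf (~` Q))) -(fineK (Lf setT)).
rewrite -(fineK (pLf Q)) -(fineK (pLf (~` Q))) -(fineK (pLf setT)).
rewrite -!EFinD !lee_fin.
lra.
Qed.

End sum.

End disjoint_covers.

(** * Inequalities for powers and logarithms *)

Section power_log.
Local Open Scope ring_scope.
Context (R : realType).
Implicit Types (x y t l u : R).

(** In this section t stands for ln z, so that expR (x * t) is z^x and t * expR (x * t) is z^x log
    z. The quadratic bound controls the derivative t^2 e^(xt) in [texp_lip]; the 4 comes from
    squaring t / 2 <= e^(t / 2). *)
Lemma expR_ge_sqr t : 0 <= t -> t ^+ 2 / 4 <= expR t.
Proof.
move=> t0; have -> : expR t = expR (t / 2) ^+ 2.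
  by rewrite expr2 -expRD -splitr.
have := expR_ge1Dx (t / 2); move=> le1; nra.
Qed.

(** From e^(-xt) >= 1 - xt. Being uniform in x >= l, the bound yields the shift 1 / l that makes all
    Z^x log Z nonnegative. *)
Lemma texp_ge l x t : 0 < l -> l <= x -> - l^-1 <= t * expR (x * t).
Proof.
move=> l0 lx; have x0 : 0 < x := lt_le_trans l0 lx.
have e0 := expR_gt0 (x * t).
have : - x^-1 <= t * expR (x * t).
  have := expR_ge1Dx (- (x * t)); rewrite expRN => le1.
  have : - (x * t) * expR (x * t) <= 1.
    rewrite -ler_pdivlMr// div1r; lra.
  move=> le2; rewrite -(ler_pM2l x0) mulrN divff ?gt_eqF//; lra.
by apply: le_trans; rewrite lerN2 lef_pV2.
Qed.

(** The tangent at x to the convex function y |-> e^(yt); with the endpoints exchanged it gives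
    [expB_le_texp]. *)
Lemma texp_le_expB x y t :
  (y - x) * (t * expR (x * t)) <= expR (y * t) - expR (x * t).
Proof.
have -> : expR (y * t) = expR (x * t) * expR ((y - x) * t).
  by rewrite -expRD; congr expR; ring.
have := expR_ge1Dx ((y - x) * t); have := expR_gt0 (x * t) => e0 le1.
have := ler_wpM2l (ltW e0) le1; lra.
Qed.

Lemma expB_le_texp x y t :
  expR (y * t) - expR (x * t) <= (y - x) * (t * expR (y * t)).
Proof. have := texp_le_expB y x t; lra. Qed.

Lemma texp_mono x y t : x <= y -> t * expR (x * t) <= t * expR (y * t).
Proof.
move=> xy; have [t0|/ltW t0] := leP 0 t.
  by apply: ler_wpM2l => //; rewrite ler_expR; apply: ler_wpM2r.
by apply: ler_wnM2l => //; rewrite ler_expR; apply: ler_wnM2r.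
Qed.

(** The derivative in x is t^2 e^(xt). For t >= 0 it is largest at u, where the spare factor e^((1 -
    u) t) absorbs t^2; for t <= 0 it is largest at l, where e^(lt) does. The constant adds the two
    cases. *)
Lemma texp_lip l u x y t : 0 < l -> u < 1 -> l <= x -> x <= y -> y <= u ->
  t * expR (y * t) <=
    t * expR (x * t) + (4 / (1 - u) ^+ 2 + 4 / l ^+ 2) * (y - x) * (1 + expR t).
Proof.
move=> l0 u1 lx xy yu; rewrite -lerBlDl.
have et := expR_gt0 t; have yx : 0 <= y - x by rewrite subr_ge0.
have u10 : 0 < 1 - u by rewrite subr_gt0.
have c1 : 0 < 4 / (1 - u) ^+ 2 by rewrite divr_gt0// exprn_gt0.
have c2 : 0 < 4 / l ^+ 2 by rewrite divr_gt0// exprn_gt0.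
have [t0|/ltW t0] := leP 0 t.
  have le1 : t ^+ 2 * expR (y * t) <= 4 / (1 - u) ^+ 2 * expR t.
    have := expR_ge_sqr (mulr_ge0 (ltW u10) t0).
    have -> : expR t = expR ((1 - u) * t) * expR (u * t).
      by rewrite -expRD; congr expR; ring.
    rewrite exprMn => le2.
    have le3 : t ^+ 2 <= 4 / (1 - u) ^+ 2 * expR ((1 - u) * t).
      rewrite mulrAC ler_pdivlMr ?exprn_gt0//; lra.
    rewrite mulrA; apply: ler_pM => //; rewrite ?sqr_ge0 ?expR_ge0//.
    by rewrite ler_expR; apply: ler_wpM2r.
  have := ler_wpM2l t0 (expB_le_texp x y t).
  have := ler_wpM2l yx le1.
  have : 0 <= 4 / l ^+ 2 * (y - x) * (1 + expR t).
    exact: mulr_ge0 (mulr_ge0 (ltW c2) yx) (addr_ge0 ler01 (ltW et)).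
  have : 0 <= 4 / (1 - u) ^+ 2 * (y - x) by exact: mulr_ge0 (ltW c1) yx.
  lra.
have le1 : t ^+ 2 * expR (x * t) <= 4 / l ^+ 2.
  have nt0 : 0 <= - t by rewrite oppr_ge0.
  have := expR_ge_sqr (mulr_ge0 (ltW l0) nt0).
  rewrite exprMn sqrrN => le2.
  have le3 : t ^+ 2 <= 4 / l ^+ 2 * expR (l * - t).
    rewrite mulrAC ler_pdivlMr ?exprn_gt0//; lra.
  apply: (@le_trans _ _ (4 / l ^+ 2 * expR (l * - t) * expR (l * t))).
    apply: ler_pM => //; rewrite ?sqr_ge0 ?expR_ge0//.
    by rewrite ler_expR; apply: ler_wnM2r.
  by rewrite -mulrA -expRD mulrN addNr expR0 mulr1.
have := ler_wnM2l t0 (texp_le_expB x y t).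
have := ler_wpM2l yx le1.
have : 0 <= 4 / (1 - u) ^+ 2 * (y - x) * (1 + expR t).
  exact: mulr_ge0 (mulr_ge0 (ltW c1) yx) (addr_ge0 ler01 (ltW et)).
have : 0 <= 4 / l ^+ 2 * (y - x) * expR t.
  exact: mulr_ge0 (mulr_ge0 (ltW c2) yx) (ltW et).
lra.
Qed.

Lemma texp_le u x t : u < 1 -> x <= u ->
  t * expR (x * t) <= (1 - u)^-1 * (1 + expR t).
Proof.
move=> u1 xu; have u10 : 0 < 1 - u by rewrite subr_gt0.
have i0 : 0 < (1 - u)^-1 by rewrite invr_gt0.
have et := expR_gt0 t.
have [t0|/ltW t0] := leP 0 t; last first.
  apply: (@le_trans _ _ 0).
    by apply: mulr_le0_ge0 => //; exact: expR_ge0.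
  by apply: mulr_ge0; [exact: ltW|lra].
apply: (@le_trans _ _ ((1 - u)^-1 * expR t)); last first.
  by apply: ler_wpM2l; [exact: ltW|lra].
have -> : expR t = expR ((1 - u) * t) * expR (u * t).
  by rewrite -expRD; congr expR; ring.
rewrite mulrA; apply: ler_pM => //; rewrite ?expR_ge0//.
  rewrite mulrC ler_pdivlMr// mulrC; have := expR_ge1Dx ((1 - u) * t); lra.
by rewrite ler_expR; apply: ler_wpM2r.
Qed.

Lemma exp_le_1D x t : 0 <= x <= 1 -> expR (x * t) <= 1 + expR t.
Proof.
move=> /andP[x0 x1]; have [t0|/ltW t0] := leP 0 t.
  have : expR (x * t) <= expR t by rewrite ler_expR ler_piMl.
  lra.
have : expR (x * t) <= 1 by rewrite -expR0 ler_expR mulr_ge0_le0.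
have := expR_gt0 t; lra.
Qed.

End power_log.

Section epower_log.
Context (R : realType).
Implicit Types (z : \bar R) (x y l u : R).

Definition powlog x z := (z `^ x) * lne z.

Lemma powlog0 x : (0 < x)%R -> powlog x 0 = 0.
Proof. by move=> x0; rewrite /powlog poweR0r ?gt_eqF// mul0e. Qed.

Lemma powlogy x : (0 < x)%R -> powlog x +oo = +oo.
Proof. by move=> x0; rewrite /powlog poweRyr ?gt_eqF//= mulyy. Qed.

Lemma powlogE x (r : R) : (0 < r)%R ->
  powlog x r%:E = (ln r * expR (x * ln r))%:E.
Proof.
by move=> r0; rewrite /powlog lne_EFin// poweR_EFin /powR gt_eqF// -EFinM mulrC.
Qed.

Lemma poweRE_gt0 x (r : R) : (0 < r)%R -> r%:E `^ x = (expR (x * ln r))%:E.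
Proof. by move=> r0; rewrite poweR_EFin /powR gt_eqF. Qed.

(** Z may be 0 or +oo: the inequalities in t = ln z cover the positive reals, and these two values
    are checked against the conventions. *)
Lemma ge0_ind (P : \bar R -> Prop) : P 0 -> P +oo ->
  (forall r : R, (0 < r)%R -> P r%:E) -> forall z, 0 <= z -> P z.
Proof.
move=> P0 Py Pr [r| |]//; rewrite lee_fin le_eqVlt => /predU1P[<-//|r0].
exact: Pr.
Qed.

Lemma ge0_neqNy z : 0 <= z -> z != -oo.
Proof. by case: z. Qed.

Lemma powlog_ge l x z : (0 < l)%R -> (l <= x)%R -> 0 <= z ->
  0 <= powlog x z + (l^-1)%:E.
Proof.
move=> l0 lx; have x0 := lt_le_trans l0 lx.
move: z; apply: ge0_ind => [||r r0].
- by rewrite powlog0// add0e lee_fin invr_ge0 ltW.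
- by rewrite powlogy// addye.
- rewrite powlogE// -EFinD lee_fin; have := texp_ge (ln r) l0 lx; lra.
Qed.

(** The term (y - x) C is added to both sides of the tangent inequality: for C = l^-1 both are then
    nonnegative and can be integrated summand by summand. *)
Lemma powlog_lower (C : R) x y z : (0 < x)%R -> (x <= y)%R -> 0 <= z ->
  (y - x)%:E * (powlog x z + C%:E) + z `^ x <= z `^ y + ((y - x) * C)%:E.
Proof.
move=> x0 xy; have y0 := lt_le_trans x0 xy.
move: z; apply: ge0_ind => [||r r0].
- by rewrite powlog0// !poweR0r ?gt_eqF// !add0e adde0 EFinM.
- by rewrite (poweRyr (lt0r_neq0 y0)) addye ?leey.
- rewrite powlogE// !poweRE_gt0// -!EFinD lee_fin.
  have := texp_le_expB x y (ln r); lra.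
Qed.

Lemma powlog_upper (C : R) x y z : (0 < x)%R -> (x <= y)%R -> 0 <= z ->
  z `^ y + ((y - x) * C)%:E <= z `^ x + (y - x)%:E * (powlog y z + C%:E).
Proof.
move=> x0 xy; have y0 := lt_le_trans x0 xy.
move: z; apply: ge0_ind => [||r r0].
- by rewrite powlog0// !poweR0r ?gt_eqF// !add0e EFinM.
- rewrite (poweRyr (lt0r_neq0 x0)) powlogy// [+oo + C%:E]addye//.
  by rewrite addye ?leey// ge0_neqNy// mule_ge0// lee_fin subr_ge0.
- rewrite powlogE// !poweRE_gt0// -!EFinD lee_fin.
  have := expB_le_texp x y (ln r); lra.
Qed.

Lemma powlog_mono x y z : (0 < x)%R -> (x <= y)%R -> 0 <= z ->
  powlog x z <= powlog y z.
Proof.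
move=> x0 xy; have y0 := lt_le_trans x0 xy.
move: z; apply: ge0_ind => [||r r0]; first by rewrite !powlog0.
  by rewrite !powlogy.
by rewrite !powlogE// lee_fin texp_mono.
Qed.

Lemma powlog_lip l u x y z : (0 < l)%R -> (u < 1)%R ->
    (l <= x)%R -> (x <= y)%R -> (y <= u)%R -> 0 <= z ->
  powlog y z <=
  powlog x z + ((4 / (1 - u) ^+ 2 + 4 / l ^+ 2) * (y - x))%:E * (1 + z).
Proof.
move=> l0 u1 lx xy yu; have x0 := lt_le_trans l0 lx.
have y0 := lt_le_trans x0 xy.
have c0 : (0 <= (4 / (1 - u) ^+ 2 + 4 / l ^+ 2) * (y - x))%R.
  by rewrite mulr_ge0 ?subr_ge0// addr_ge0 ?divr_ge0 ?sqr_ge0.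
move: z; apply: ge0_ind => [||r r0].
- by rewrite !powlog0// add0e adde0 mule1 lee_fin.
- by rewrite !powlogy// addye// ge0_neqNy// mule_ge0// ?adde_ge0// lee_fin.
- rewrite !powlogE// -(EFinD 1) -EFinM -EFinD lee_fin.
  by have := texp_lip (ln r) l0 u1 lx xy yu; rewrite lnK// posrE.
Qed.

Lemma powlog_le l u x z : (u < 1)%R -> (0 < x)%R -> (x <= u)%R -> 0 <= z ->
  powlog x z <= (1 - u)^-1%:E * (1 + z).
Proof.
move=> u1 x0 xu; have u10 : (0 < 1 - u)%R by rewrite subr_gt0.
move: z; apply: ge0_ind => [||r r0].
- by rewrite powlog0// adde0 mule1 lee_fin invr_ge0 ltW.
- by rewrite powlogy// addey// gt0_muley// lte_fin invr_gt0.
- rewrite powlogE// -EFinD -EFinM lee_fin.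
  by have := texp_le (ln r) u1 xu; rewrite lnK// posrE.
Qed.

Lemma poweR_le_1D x z : (0 < x <= 1)%R -> 0 <= z -> z `^ x <= 1 + z.
Proof.
move=> /andP[x0 x1]; move: z; apply: ge0_ind => [||r r0].
- by rewrite poweR0r ?gt_eqF// adde0 lee01.
- by rewrite poweRyr ?gt_eqF// addey.
- rewrite poweRE_gt0// -EFinD lee_fin.
  by have := @exp_le_1D _ x (ln r); rewrite ltW// x1 lnK ?posrE// => /(_ isT).
Qed.

Lemma measurable_lne : measurable_fun [set: \bar R] (@lne R).
Proof.
rewrite (_ : @lne R = fun z => if z == +oo then +oo else
    if (z <= 0) then -oo else (ln (fine z))%:E); last first.
  by apply/funext => -[r| |]//=; rewrite ?lee_fin ?leNye.
apply: measurable_fun_ifT; first exact: measurable_fun_eqe.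
  exact: measurable_cst.
apply: measurable_fun_ifT; first exact: measurable_fun_lee.
  exact: measurable_cst.
apply/measurable_EFinP; exact: measurableT_comp.
Qed.

Lemma measurable_powlog x : measurable_fun [set: \bar R] (powlog x).
Proof.
by apply: emeasurable_funM; [exact: measurable_poweR|exact: measurable_lne].
Qed.

End epower_log.

(** * One-sided derivatives of lower envelopes of convex families *)

(* Intended reading: [D e] is a set of covers that are optimal up to [e], and
   [h x A], [L x A] are the sums over the cover [A] of the integrals of Z `^ x
   and Z `^ x * ln Z, so that [L x A] is the derivative of [h x A] in [x]. *)
Record convex_family (R : realType) (T : Type) (D : R -> set T)
    (h L : R -> T -> R) (H : R -> R) (l u K : R) : Prop := ConvexFamily {
  cf_D : forall e e', (0 < e)%R -> (e <= e')%R -> (e' <= 1)%R -> D e `<=` D e' ;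
  cf_K : (0 <= K)%R ;
  cf_lower : forall x y A, D 1%R A -> (l <= x)%R -> (x <= y)%R -> (y <= u)%R ->
    ((y - x) * L x A <= h y A - h x A)%R ;
  cf_upper : forall x y A, D 1%R A -> (l <= x)%R -> (x <= y)%R -> (y <= u)%R ->
    (h y A - h x A <= (y - x) * L y A)%R ;
  cf_mono : forall x y A, D 1%R A -> (l <= x)%R -> (x <= y)%R -> (y <= u)%R ->
    (L x A <= L y A)%R ;
  cf_lip : forall x y A, D 1%R A -> (l <= x)%R -> (x <= y)%R -> (y <= u)%R ->
    (L y A <= L x A + K * (y - x))%R ;
  cf_bound : forall x A, D 1%R A -> (l <= x <= u)%R -> (`|L x A| <= K)%R ;
  cf_inf : forall x eta, (l <= x <= u)%R -> (0 < eta)%R ->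
    exists2 e, (0 < e <= 1)%R & forall A, D e A -> (H x - eta <= h x A)%R ;
  cf_ex : forall x e, (l <= x <= u)%R -> (0 < e <= 1)%R ->
    exists2 A, D e A & (h x A < H x + e)%R }.

Section convex_family.
Local Open Scope ring_scope.
Context (R : realType) (T : Type) (D : R -> set T) (h L : R -> T -> R)
  (H : R -> R) (l u K : R).
Hypothesis cf : convex_family D h L H l u K.

Definition near_opt b e : set T := [set A | D e A /\ h b A < H b + e].

Lemma cf_D1 e A : 0 < e <= 1 -> D e A -> D 1 A.
Proof. by move=> /andP[e0 e1]; exact: (cf_D cf e0 e1 (lexx 1)). Qed.

Lemma cf_lipL x y A : D 1 A -> l <= x <= u -> l <= y <= u ->
  `|L x A - L y A| <= K * `|x - y|.
Proof.
move=> DA /andP[lx xu] /andP[ly yu].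
have [xy|/ltW yx] := leP x y.
  have := cf_mono cf DA lx xy yu; have := cf_lip cf DA lx xy yu.
  by rewrite ler_norml (ler0_norm (_ : x - y <= 0)) ?subr_le0// => ? ?; lra.
have := cf_mono cf DA ly yx xu; have := cf_lip cf DA ly yx xu.
by rewrite ler_norml (ger0_norm (_ : 0 <= x - y)) ?subr_ge0// => ? ?; lra.
Qed.

Lemma cf_liph x y A : D 1 A -> l <= x <= u -> l <= y <= u ->
  `|h x A - h y A| <= K * `|x - y|.
Proof.
move=> DA /andP[lx xu] /andP[ly yu].
wlog xy : x y lx xu ly yu / x <= y.
  move=> W; have [|/ltW] := leP x y; first exact: W.
  by rewrite distrC (distrC x); exact: W.
have := cf_lower cf DA lx xy yu; have := cf_upper cf DA lx xy yu.
have := cf_bound cf DA (_ : l <= x <= u); rewrite lx xu => /(_ isT).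
have := cf_bound cf DA (_ : l <= y <= u); rewrite ly yu => /(_ isT).
rewrite !ler_norml (ler0_norm (_ : x - y <= 0)) ?subr_le0//.
move=> /andP[_ Ly] /andP[Lx _] hu hl.
have xy0 : 0 <= y - x by rewrite subr_ge0.
have := ler_wpM2l xy0 Ly; have := ler_wpM2l xy0 Lx; lra.
Qed.

Lemma cf_lipH x y : l <= x <= u -> l <= y <= u -> `|H x - H y| <= K * `|x - y|.
Proof.
wlog suff W : x y / l <= x <= u -> l <= y <= u -> H x - H y <= K * `|x - y|.
  move=> xI yI; rewrite ler_norml; have := W _ _ yI xI; have := W _ _ xI yI.
  rewrite (distrC y); lra.
move=> xI yI; apply/ler_addgt0Pr => e e0.
have e20 : 0 < e / 2 by rewrite divr_gt0.
have [e1 /andP[e10 e11] hx] := cf_inf cf xI e20.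
pose e2 := Num.min e1 (e / 2).
have e2I : 0 < e2 <= 1 by rewrite lt_min e10 e20 ge_min e11.
have [A DA hy] := cf_ex cf yI e2I.
have e2e1 : e2 <= e1 by rewrite ge_min lexx.
have e2e : e2 <= e / 2 by rewrite ge_min lexx orbT.
case/andP: (e2I) => e20' _.
have := hx A (cf_D cf e20' e2e1 e11 DA).
have := cf_liph (cf_D1 e2I DA) xI yI; rewrite ler_norml => /andP[_]; lra.
Qed.

(** h and H each change by at most K |b - a|, whence the factor 2. *)
Lemma near_opt_sub a b e e' : l <= a <= u -> l <= b <= u -> 0 < e -> e' <= 1 ->
  e + 2 * K * `|b - a| <= e' -> near_opt b e `<=` near_opt a e'.
Proof.
move=> aI bI e0 e'1 ee' A [DA hA].
have K0 := cf_K cf; have ba := normr_ge0 (b - a).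
have Kba : 0 <= K * `|b - a| by exact: mulr_ge0.
have ee1 : e <= e' by lra.
have DA' := cf_D cf e0 ee1 e'1 DA; split => //.
have D1A : D 1 A by apply: cf_D1 DA; rewrite e0 (le_trans ee1).
have := cf_liph D1A aI bI; have := cf_lipH bI aI; rewrite (distrC a).
rewrite !ler_norml => /andP[_ ?] /andP[_ ?]; lra.
Qed.

Lemma near_opt_ex b e : l <= b <= u -> 0 < e <= 1 -> near_opt b e !=set0.
Proof. by move=> bI eI; have [A DA hA] := cf_ex cf bI eI; exists A. Qed.

(** X1 bounds the slopes at b of covers optimal for a, and X2 is at most every bound for the slopes
    at a of covers optimal for b. So h b - h a <= (b - a) X1 and H b - H a >= (b - a) X2 - e - k,
    which turns optimality for a into optimality for b. With k = (b - a)^tau, e' is the formula of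
    [eps']. *)
Lemma near_opt_shift a b (P1 P2 : set T) (X1 X2 k e : R) :
    l <= a -> a < b -> b <= u -> 0 < e <= 1 ->
    (forall A, D e A -> H a - k <= h a A) ->
    (forall A, D e A -> H b - k <= h b A) ->
    P1 !=set0 -> P1 `<=` near_opt a e -> P2 `<=` near_opt b e ->
    (forall A, P1 A -> L b A <= X1) ->
    (forall v, (forall A, P2 A -> L a A <= v) -> X2 <= v) ->
  let e' := (b - a) * (X1 - X2) + 2 * k + 3 * e in
  e <= e' /\ forall A, P1 A -> h b A < H b + e'.
Proof.
move=> la ab bu eI Ha Hb [A1 P1A1] P1a P2b X1ub X2lub e'.
have [e0 e1] := andP eI; have t0 : 0 < b - a by rewrite subr_gt0.
have up A : P1 A -> h b A - h a A <= (b - a) * X1.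
  move=> P1A; have nA := P1a A P1A.
  apply: le_trans (cf_upper cf (cf_D1 eI nA.1) la (ltW ab) bu) _.
  by apply: ler_wpM2l; [exact: ltW|exact: X1ub].
have [DA1 hA1] := P1a _ P1A1.
have lo1 : H b - k - H a - e <= (b - a) * X1.
  by apply: le_trans (up _ P1A1); have := Hb _ DA1; lra.
have lo2 : (b - a) * X2 <= H b + e - H a + k.
  rewrite -ler_pdivlMl//; apply: X2lub => A P2A; rewrite ler_pdivlMl//.
  have [DA hA] := P2b A P2A.
  have := cf_lower cf (cf_D1 eI DA) la (ltW ab) bu.
  by have := Ha A DA; lra.
(* [lo1] and [lo2] give (b - a) (X1 - X2) >= - 2 k - 2 e, and the coefficients 2 and 3 in e' turn
   this into e <= e'. *)
rewrite /e'; split=> [|A P1A]; first by lra.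
have := up _ P1A; have [DA hA] := P1a A P1A; have := Ha A DA; lra.
Qed.

(** The limit, as e tends to 0, of the suprema of L a over the covers optimal up to e, written as
    the infimum of their upper bounds. *)
Definition left_slope a :=
  inf [set y | exists2 e, 0 < e <= 1 & forall A, near_opt a e A -> L a A <= y].

Section at_point.
Variable a : R.
Hypotheses (la : l < a) (au : a < u).

Let aI : l <= a <= u. Proof. by rewrite !ltW. Qed.

Let left_slope_lb : has_lbound
  [set y | exists2 e, 0 < e <= 1 & forall A, near_opt a e A -> L a A <= y].
Proof.
exists (- K) => y [e eI yA]; have [A nA] := near_opt_ex aI eI.
apply: le_trans (yA A nA); have := cf_bound cf (cf_D1 eI nA.1) aI.
by rewrite ler_norml => /andP[].
Qed.

Lemma left_slope_le e y : 0 < e <= 1 ->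
  (forall A, near_opt a e A -> L a A <= y) -> left_slope a <= y.
Proof. by move=> eI yA; apply: ge_inf => //; exists e. Qed.

Lemma left_slope_adherent eta : 0 < eta -> exists2 e, 0 < e <= 1 &
  forall A, near_opt a e A -> L a A <= left_slope a + eta.
Proof.
move=> eta0.
have [|y [e eI yA] ylt] := inf_adherent eta0 (_ : has_inf
  [set y | exists2 e, 0 < e <= 1 & forall A, near_opt a e A -> L a A <= y]).
  split => //; exists K, 1 => [|A nA]; first by rewrite ltr01 lexx.
  have := cf_bound cf nA.1 aI; by rewrite ler_norml => /andP[].
by exists e => // A /yA/le_trans; apply; exact: ltW.
Qed.

Lemma interval_near : exists2 r, 0 < r <= 1 &
  forall b, `|b - a| < r -> l <= b <= u.
Proof.
exists (Num.min 1 (Num.min (a - l) (u - a))).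
  by rewrite !lt_min ltr01 !subr_gt0 la au ge_min lexx.
move=> b; rewrite !lt_min => /and3P[_].
by rewrite !ltr_norml => /andP[? ?] /andP[? ?]; apply/andP; split; lra.
Qed.

(** A cover optimal for b is optimal for a up to an error vanishing with |b - a|, and L is Lipschitz
    in the exponent. Since b may lie on either side of a, the bound also serves the limits from the
    right along [eps']. *)
Lemma le_left_slope eta : 0 < eta -> exists2 r, 0 < r <= 1 &
  forall b c e A, `|b - a| < r -> `|c - a| < r -> 0 < e <= r ->
    near_opt b e A -> L c A <= left_slope a + eta.
Proof.
move=> eta0; have K0 := cf_K cf.
have [e0 /andP[e00 e01] He0] := left_slope_adherent (divr_gt0 eta0 (ltr0Sn _ 1)).
have [r0 /andP[r00 r01] Hr0] := interval_near.
have K1 : 0 < 2 * K + 1 by lra.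
(* This keeps e + 2 K |b - a| below e0 and K |c - a| below eta / 2. *)
pose r := Num.min r0 (Num.min (e0 / 2 / (2 * K + 1)) (eta / 2 / (2 * K + 1))).
have rr0 : r <= r0 by rewrite ge_min lexx.
have r1 : r * (2 * K + 1) <= e0 / 2 by rewrite -ler_pdivlMr// !ge_min lexx orbT.
have r2 : r * (2 * K + 1) <= eta / 2 by rewrite -ler_pdivlMr// !ge_min lexx !orbT.
have rp : 0 < r by rewrite !lt_min r00 !divr_gt0.
exists r; first by rewrite rp (le_trans rr0).
move=> b c e A ba ca /andP[ep er] nA.
have bI := Hr0 b (lt_le_trans ba rr0); have cI := Hr0 c (lt_le_trans ca rr0).
have D1A : D 1 A by apply: cf_D1 nA.1; rewrite ep (le_trans er)// (le_trans rr0).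
have Kb : K * `|b - a| <= K * r by apply: ler_wpM2l => //; exact: ltW.
have Kc : K * `|c - a| <= K * r by apply: ler_wpM2l => //; exact: ltW.
have Kr : 0 <= K * r by rewrite mulr_ge0// ltW.
have nA' : near_opt a e0 A by apply: near_opt_sub nA => //; lra.
have := He0 A nA'; have := cf_lipL D1A cI aI; rewrite ler_norml => /andP[_]; lra.
Qed.

Lemma quotient_le_left_slope eta : 0 < eta -> exists2 r, 0 < r <= 1 &
  forall b, a - r < b < a -> H a - H b <= (a - b) * (left_slope a + eta).
Proof.
move=> eta0; have [r0 /andP[r00 r01] Hr0] := interval_near.
have [r1 /andP[r10 r11] Hr1] := le_left_slope (divr_gt0 eta0 (ltr0Sn _ 1)).
exists (Num.min r0 r1); first by rewrite lt_min r00 r10 ge_min r01.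
move=> b /andP[+ ba]; rewrite ltrBlDr addrC -ltrBlDr lt_min => /andP[b0 b1].
have abp : 0 < a - b by rewrite subr_gt0.
have nba : `|b - a| = a - b by rewrite distrC gtr0_norm.
have bI : l <= b <= u by apply: Hr0; rewrite nba.
(* Two optimality errors of (a - b) eta / 4 each; the remaining eta / 2 is spent on L a. *)
have k0 : 0 < (a - b) * (eta / 4) by rewrite mulr_gt0// divr_gt0.
have [e1 /andP[e10 e11] He1] := cf_inf cf aI k0.
pose e := Num.min e1 (Num.min r1 ((a - b) * (eta / 4))).
have ep : 0 < e by rewrite !lt_min e10 r10.
have ee1 : e <= e1 by rewrite ge_min lexx.
have er1 : e <= r1 by rewrite !ge_min lexx orbT.
have ek : e <= (a - b) * (eta / 4) by rewrite !ge_min lexx !orbT.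
have eI : 0 < e <= 1 by rewrite ep (le_trans ee1).
have [A nA] := near_opt_ex bI eI.
have D1A := cf_D1 eI nA.1.
have LA : L a A <= left_slope a + eta / 2.
  by apply: (Hr1 b a e A) => //; rewrite ?nba ?subrr ?normr0 ?ep.
have := He1 A (cf_D cf ep ee1 e11 nA.1).
have := ltW nA.2.
have lb : l <= b by case/andP: bI.
have := cf_upper cf D1A lb (ltW ba) (ltW au).
have := ler_wpM2l (ltW abp) LA.
lra.
Qed.

Lemma left_slope_le_quotient eta : 0 < eta -> exists2 r, 0 < r <= 1 &
  forall b, a - r < b < a -> (a - b) * (left_slope a - eta) <= H a - H b.
Proof.
move=> eta0; have [r0 /andP[r00 r01] Hr0] := interval_near.
have K0 := cf_K cf; have K1 : 0 < 2 + K by lra.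
exists (Num.min r0 (eta / (2 + K))).
  by rewrite lt_min r00 divr_gt0// ge_min r01.
move=> b /andP[+ ba]; rewrite ltrBlDr addrC -ltrBlDr lt_min ltr_pdivlMr//.
move=> /andP[b0 b1].
have abp : 0 < a - b by rewrite subr_gt0.
have nba : `|b - a| = a - b by rewrite distrC gtr0_norm.
have bI : l <= b <= u by apply: Hr0; rewrite nba.
(* After division by a - b the two quadratic errors contribute 2 (a - b), and replacing L b by L a
   contributes K (a - b); hence the constant 2 + K. *)
have k0 : 0 < (a - b) * (a - b) by rewrite mulr_gt0.
have [e1 /andP[e10 e11] He1] := cf_inf cf bI k0.
pose e := Num.min e1 ((a - b) * (a - b)).
have ep : 0 < e by rewrite lt_min e10.
have ee1 : e <= e1 by rewrite ge_min lexx.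
have ek : e <= (a - b) * (a - b) by rewrite !ge_min lexx !orbT.
have eI : 0 < e <= 1 by rewrite ep (le_trans ee1).
have lb : l <= b by case/andP: bI.
have : left_slope a <= (H a - H b) / (a - b) + (2 + K) * (a - b).
  apply: (left_slope_le eI) => A [DA hA].
  have D1A := cf_D1 eI DA.
  have hb := He1 A (cf_D cf ep ee1 e11 DA).
  have lo := cf_lower cf D1A lb (ltW ba) (ltW au).
  have li := cf_lip cf D1A lb (ltW ba) (ltW au).
  suff : L b A <= (H a - H b) / (a - b) + 2 * (a - b) by lra.
  rewrite -(ler_pM2l abp) mulrDr mulrCA divff ?gt_eqF// mulr1; lra.
rewrite -(ler_pM2l abp) mulrDr mulrCA divff ?gt_eqF// mulr1 => le1.
have : (a - b) * ((2 + K) * (a - b)) <= (a - b) * eta.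
  by apply: ler_wpM2l; [exact: ltW|rewrite mulrC ltW].
lra.
Qed.

(* A cover that is optimal for b up to e and has [h a] at least [H a - k] has
   [L a] at least the difference quotient of H, up to (e + k) / (a - b). *)
Lemma ge_left_slope eta : 0 < eta -> exists2 r, 0 < r <= 1 &
  forall b c e k A, a - r < b < a -> `|c - a| < r -> 0 < e <= 1 ->
    e + k <= r * (a - b) -> (forall A', D e A' -> H a - k <= h a A') ->
    near_opt b e A -> left_slope a - eta <= L c A.
Proof.
move=> eta0; have [r0 /andP[r00 r01] Hr0] := interval_near.
have e30 : 0 < eta / 3 by rewrite divr_gt0.
have [r1 /andP[r10 r11] Hr1] := left_slope_le_quotient e30.
have K0 := cf_K cf; have K1 : 0 < K + 1 by lra.
pose r := Num.min r0 (Num.min r1 (eta / 3 / (K + 1))).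
have rp : 0 < r by rewrite !lt_min r00 r10 !divr_gt0.
have rr0 : r <= r0 by rewrite ge_min lexx.
have rr1 : r <= r1 by rewrite !ge_min lexx orbT.
have rK : r * (K + 1) <= eta / 3 by rewrite -ler_pdivlMr// !ge_min lexx !orbT.
exists r; first by rewrite rp (le_trans rr0).
move=> b c e k A /andP[rb ba] ca eI ek Dh [DA hA].
have abp : 0 < a - b by rewrite subr_gt0.
have nba : `|b - a| = a - b by rewrite distrC gtr0_norm.
have bI : l <= b <= u by apply: Hr0; rewrite nba; lra.
have lb : l <= b by case/andP: bI.
have cI := Hr0 c (lt_le_trans ca rr0).
have D1A := cf_D1 eI DA.
have hk := Dh A DA.
have up := cf_upper cf D1A lb (ltW ba) (ltW au).
have qb : (a - b) * (left_slope a - eta / 3) <= H a - H b.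
  by apply: Hr1; rewrite ba andbT; lra.
have Kr : 0 <= K * r by rewrite mulr_ge0// ltW.
have La : left_slope a - eta / 3 - r <= L a A.
  rewrite -(ler_pM2l abp); lra.
have Kc : K * `|c - a| <= K * r by apply: ler_wpM2l => //; exact: ltW.
have := cf_lipL D1A cI aI; rewrite ler_norml => /andP[+ _]; lra.
Qed.

End at_point.

(** Under reflection the lower and the upper tangent inequality exchange their roles and the slope
    changes sign. *)
Lemma convex_family_opp :
  convex_family D (fun x => h (- x)) (fun x A => - L (- x) A)
    (fun x => H (- x)) (- u) (- l) K.
Proof.
have opI x : (- u <= x <= - l) -> l <= - x <= u.
  by move=> /andP[? ?]; apply/andP; split; lra.
split; [exact: cf_D cf|exact: cf_K cf| | | | | | |].
- move=> x y A DA ux xy yl.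
  have := cf_upper cf DA (_ : l <= - y) (_ : - y <= - x) (_ : - x <= u).
  rewrite lerNr lerN2 lerNl => /(_ yl xy ux); lra.
- move=> x y A DA ux xy yl.
  have := cf_lower cf DA (_ : l <= - y) (_ : - y <= - x) (_ : - x <= u).
  rewrite lerNr lerN2 lerNl => /(_ yl xy ux); lra.
- move=> x y A DA ux xy yl.
  have := cf_mono cf DA (_ : l <= - y) (_ : - y <= - x) (_ : - x <= u).
  rewrite lerNr lerN2 lerNl => /(_ yl xy ux); lra.
- move=> x y A DA ux xy yl.
  have := cf_lip cf DA (_ : l <= - y) (_ : - y <= - x) (_ : - x <= u).
  rewrite lerNr lerN2 lerNl => /(_ yl xy ux); lra.
- by move=> x A DA /opI xI; rewrite normrN; exact: (cf_bound cf DA xI).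
- by move=> x eta xI e0; exact: (cf_inf cf (opI x xI) e0).
- by move=> x e xI eI; exact: (cf_ex cf (opI x xI) eI).
Qed.

End convex_family.

Section right_slope.
Local Open Scope ring_scope.
Context (R : realType) (T : Type) (D : R -> set T) (h L : R -> T -> R)
  (H : R -> R) (l u K : R).
Hypothesis cf : convex_family D h L H l u K.

(* The reflection x |-> - x exchanges the two sides. *)
Definition right_slope a := - left_slope D (fun x => h (- x))
  (fun x A => - L (- x) A) (fun x => H (- x)) (- a).

Variable a : R.
Hypotheses (la : l < a) (au : a < u).

Let ua : - u < - a. Proof. by rewrite ltrN2. Qed.
Let al : - a < - l. Proof. by rewrite ltrN2. Qed.

Let near_optN b e A : near_opt D h H b e A ->
  near_opt D (fun x => h (- x)) (fun x => H (- x)) (- b) e A.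
Proof. by rewrite /near_opt /= opprK. Qed.

Let distN b : `|- b - - a| = `|b - a|.
Proof. by rewrite opprK addrC distrC. Qed.

Lemma ge_right_slope eta : 0 < eta -> exists2 r, 0 < r <= 1 &
  forall b c e A, `|b - a| < r -> `|c - a| < r -> 0 < e <= r ->
    near_opt D h H b e A -> right_slope a - eta <= L c A.
Proof.
move=> eta0; have [r rI Hr] := le_left_slope (convex_family_opp cf) ua al eta0.
exists r => // b c e A ba ca er /near_optN nA.
have := Hr (- b) (- c) e A; rewrite !distN => /(_ ba ca er nA).
by rewrite opprK /right_slope => ?; lra.
Qed.

Lemma le_right_slope eta : 0 < eta -> exists2 r, 0 < r <= 1 &
  forall b c e k A, a < b < a + r -> `|c - a| < r -> 0 < e <= 1 ->
    e + k <= r * (b - a) -> (forall A', D e A' -> H a - k <= h a A') ->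
    near_opt D h H b e A -> L c A <= right_slope a + eta.
Proof.
move=> eta0; have [r rI Hr] := ge_left_slope (convex_family_opp cf) ua al eta0.
exists r => // b c e k A /andP[ab br] ca eI ek Dh /near_optN nA.
have := Hr (- b) (- c) e k A; rewrite distN !opprK (addrC _ b).
have abr : - a - r < - b < - a by apply/andP; split; lra.
by move=> /(_ abr ca eI ek Dh nA); rewrite /right_slope => ?; lra.
Qed.

End right_slope.

(** * Measures with density and sums of integrals over covers *)

Section density.
Context (d : measure_display) (T : measurableType d) (R : realType)
  (mu : {measure set T -> \bar R}) (f : T -> \bar R).

(** The two proofs are arguments so that the measure structure can be attached to this function. *)
Definition density_measure of measurable_fun setT f & (forall x, 0 <= f x) :
  set T -> \bar R := fun B => \int[mu]_(x in B) f x.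

Variables (mf : measurable_fun setT f) (f0 : forall x, 0 <= f x).

Local Notation nu := (density_measure mf f0).

Let nu0 : nu set0 = 0. Proof. exact: integral_set0. Qed.

Let nu_ge0 B : 0 <= nu B. Proof. exact: integral_ge0. Qed.

Let nu_sigma : semi_sigma_additive nu.
Proof. exact: semi_sigma_additive_nng_induced. Qed.

HB.instance Definition _ := isMeasure.Build _ _ _ (density_measure mf f0)
  nu0 nu_ge0 nu_sigma.

End density.

Section weighted_sum.
Context (d : measure_display) (X : measurableType d) (R : realType)
    (S : X -> X) (bijS : bijective S)
    (phi0 : {finite_measure set (A0 S) -> \bar R}).
Implicit Types (f g : A0 S -> \bar R) (A B : (set X)^nat).

Local Notation "f \>=0" := (forall x, 0 <= f x) (at level 70).
Local Notation mfun f := (measurable_fun [set: A0 S] f).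

Definition wsum f A : \bar R :=
  cover_sum S (fun F => \int[phi0]_(x in (F : set (A0 S))) f x) A.

Definition covers_measurable A := forall n, A0_measurable S (shift_cover S A n).

Lemma wsum_ge0 f A : f \>=0 -> 0 <= wsum f A.
Proof. by move=> f0; apply: nneseries_ge0 => n _ _; exact: integral_ge0. Qed.

Lemma wsumD f g A : covers_measurable A -> mfun f -> f \>=0 -> mfun g -> g \>=0 ->
  wsum (fun x => f x + g x) A = wsum f A + wsum g A.
Proof.
move=> mA mf f0 mg g0; rewrite /wsum /cover_sum -nneseriesD; last 2 first.
- by move=> *; exact: integral_ge0.
- by move=> *; exact: integral_ge0.
apply: eq_eseriesr => n _; apply: ge0_integralD => //; first exact: mA.
  exact: measurable_funTS.
exact: measurable_funTS.
Qed.

Lemma wsumZ f A (k : R) : covers_measurable A -> mfun f -> f \>=0 -> (0 <= k)%R ->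
  wsum (fun x => k%:E * f x) A = k%:E * wsum f A.
Proof.
move=> mA mf f0 k0; rewrite /wsum /cover_sum -nneseriesZl; last first.
  by move=> *; exact: integral_ge0.
apply: eq_eseriesr => n _; apply: ge0_integralZl_EFin => //; first exact: mA.
exact: measurable_funTS.
Qed.

Lemma wsum_le f g A : covers_measurable A -> mfun f -> f \>=0 -> mfun g ->
  (forall x, f x <= g x) -> wsum f A <= wsum g A.
Proof.
move=> mA mf f0 mg fg; apply: lee_nneseries => [n _ _|n _].
  exact: integral_ge0.
apply: ge0_le_integral => //; first exact: mA.
  exact: measurable_funTS.
exact: measurable_funTS.
Qed.

Lemma wsum_subset f A B : covers_measurable A -> covers_measurable B ->
  mfun f -> f \>=0 -> (forall n, shift_cover S A n `<=` shift_cover S B n) ->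
  wsum f A <= wsum f B.
Proof.
move=> mA mB mf f0 AB; apply: lee_nneseries => [n _ _|n _].
  exact: integral_ge0.
apply: ge0_subset_integral => //; [exact: mA|exact: mB|exact: measurable_funTS|].
exact: AB.
Qed.

Lemma wsum1 A : covers_measurable A -> cover_sum S phi0 A = wsum (cst 1) A.
Proof.
move=> mA; apply: eq_eseriesr => n _.
by rewrite integral_cst ?mul1e//; exact: mA.
Qed.

(* The series of the integrals of a function bounded below need not be
   absolutely convergent, but it splits into two series of nonnegative terms. *)
Lemma wsum_signed (g : A0 S -> \bar R) (C : R) A : covers_measurable A ->
    mfun g -> (forall x, 0 <= g x + C%:E) -> (0 <= C)%R ->
    \int[phi0]_x (g x + C%:E) < +oo -> cover_sum S phi0 A < +oo ->
  wsum g A = wsum (fun x => g x + C%:E) A - C%:E * cover_sum S phi0 A.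
Proof.
move=> mA mg gC0 C0 gCoo phiA.
have mgC : mfun (fun x => g x + C%:E) by apply: emeasurable_funD.
have igC : phi0.-integrable setT (fun x => g x + C%:E).
  apply/integrableP; split => //.
  by under eq_integral do rewrite gee0_abs//.
have iC : phi0.-integrable setT (cst C%:E) by exact: finite_measure_integrable_cst.
have eqn n : \int[phi0]_(x in shift_cover S A n) g x =
    \int[phi0]_(x in shift_cover S A n) (g x + C%:E) -
    C%:E * phi0 (shift_cover S A n).
  rewrite -integral_cst; last exact: mA.
  rewrite -integralB; [|exact: mA| |].
  - by apply: eq_integral => x _; rewrite addeK.
  - by apply: integrableS igC => //; exact: mA.
  - by apply: integrableS iC => //; exact: mA.
rewrite /wsum /cover_sum -nneseriesZl//.
apply/cvg_lim => //.
rewrite [X in X @ _ --> _](_ : _ = fun N =>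
    \sum_(0 <= n < N) \int[phi0]_(x in shift_cover S A n) (g x + C%:E) -
    \sum_(0 <= n < N) C%:E * phi0 (shift_cover S A n)); last first.
  apply/funext => N; rewrite -sumeN; last first.
    move=> i j _ _; apply: fin_num_adde_defr; apply: fin_numM => //.
    by apply: fin_num_measure; exact: mA.
  by rewrite -big_split/=; apply: eq_bigr => n _; exact: eqn.
have Cphi0 n : 0 <= C%:E * phi0 (shift_cover S A n) by rewrite mule_ge0.
apply: cvgeB.
- apply: fin_num_adde_defl; rewrite fin_numN nneseriesZl//.
  by rewrite fin_numM// ge0_fin_numE// nneseries_ge0.
- apply: is_cvg_nneseries => n _ _; exact: integral_ge0.
- exact: is_cvg_nneseries.
Qed.

Context (Lambda : {finite_measure set (A0 S) -> \bar R})
    (Lambda_inv : forall A : set (A0 S), measurable A ->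
       Lambda (S @^-1` A) = Lambda A).

Definition disjoint_cover A := unshift_cover S (disjointify S (shift_cover S A)).

Lemma shift_disjoint_cover A :
  shift_cover S (disjoint_cover A) = disjointify S (shift_cover S A).
Proof. exact: unshift_coverK. Qed.

Lemma covers_covers_measurable Q A : covers S Q A -> covers_measurable A.
Proof. by move=> /(covers_base_cover bijS)[]. Qed.

Lemma disjoint_cover_covers Q A : covers S Q A -> covers S Q (disjoint_cover A).
Proof.
move=> /(covers_base_cover bijS) cA.
by apply: base_cover_covers => //; exact: disjointify_cover.
Qed.

Lemma wsum_disjoint_cover f Q A : covers S Q A -> mfun f -> f \>=0 ->
  wsum f (disjoint_cover A) <= wsum f A.
Proof.
move=> cA mf f0; apply: wsum_subset => //.
- exact: covers_covers_measurable (disjoint_cover_covers cA).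
- exact: covers_covers_measurable cA.
- by move=> n; rewrite shift_disjoint_cover; exact: disjointify_sub.
Qed.

(** The bound does not depend on the cover: it supplies uniform constants where no constraint on the
    Lambda-sum is given. *)
Lemma cover_sum_disjoint_cover Q A : covers S Q A ->
  cover_sum S Lambda (disjoint_cover A) <= Lambda setT.
Proof.
move=> cA; have mA := covers_covers_measurable cA.
rewrite [leLHS](_ : _ = \sum_(n <oo) Lambda (disjointify S (shift_cover S A) n)).
  by apply: sum_disjointify_le => //; exact: measurableT.
by rewrite -shift_disjoint_cover.
Qed.

End weighted_sum.

(** * Squeeze criteria for one-sided limits *)

Lemma cvg_between (R : realType) (T : Type) (F : set_system T) (FF : ProperFilter F)
    (f : T -> \bar R) (v : R) :
    (forall eta : R, (0 < eta)%R ->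
      \forall b \near F, (v - eta)%:E <= f b <= (v + eta)%:E) ->
  f b @[b --> F] --> v%:E.
Proof.
move=> fv.
have finE b eta : (v - eta)%:E <= f b <= (v + eta)%:E -> f b \is a fin_num.
  move=> /andP[lo hi]; rewrite fin_numE -ltNye -ltey.
  by rewrite (lt_le_trans _ lo) ?ltNyr// (le_lt_trans hi) ?ltry.
apply/fine_cvgP; split.
  near=> b; apply: (finE _ 1%R); near: b; exact: fv.
apply/cvgrPdist_le => eta eta0; near=> b.
have Hb : (v - eta)%:E <= f b <= (v + eta)%:E by near: b; exact: fv.
move: Hb (finE _ _ Hb) => /andP[lo hi] fb.
by move: lo hi; rewrite -(fineK fb) !lee_fin /= ler_norml => ? ?; apply/andP; split; lra.
Unshelve. all: by end_near. Qed.

Lemma quotient_between (R : realType) (x y a b lo hi : R) : (b < a)%R ->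
  ((a - b) * lo <= x - y)%R -> (x - y <= (a - b) * hi)%R ->
  (lo <= (y - x) * (b - a)^-1 <= hi)%R.
Proof.
move=> ba lox xhi; have t0 : (0 < a - b)%R by rewrite subr_gt0.
rewrite -(opprB x) -(opprB a) invrN mulrNN ler_pdivlMr// ler_pdivrMr//.
by rewrite (mulrC lo) (mulrC hi) lox xhi.
Qed.

(** A shift of the exponent that costs at most e in [near_opt_sub]. *)
Lemma small_shift (R : realType) (K e r : R) : (0 <= K)%R -> (0 < e)%R -> (0 < r)%R ->
  exists2 s : R, (0 < s < r)%R & (2 * K * s <= e)%R.
Proof.
move=> K0 e0 r0; have K1 : (0 < 2 * K + 1)%R by lra.
exists (Num.min (r / 2) (e / (2 * K + 1)))%R.
  by rewrite lt_min !divr_gt0// gt_min ltr_pdivrMr// ltr_pMr// ltr1n.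
have : (Num.min (r / 2) (e / (2 * K + 1)) <= e / (2 * K + 1))%R.
  by rewrite ge_min lexx orbT.
have : (0 <= Num.min (r / 2) (e / (2 * K + 1)))%R.
  by rewrite le_min !divr_ge0 ?ltW.
move: (Num.min _ _) => s s0; rewrite ler_pdivlMr// => sK; lra.
Qed.

Section one_sided_limits.
Context (R : realType) (f : R -> \bar R) (a v : R).

Lemma cvg_at_left_between : (forall eta : R, (0 < eta)%R -> exists2 r : R,
    (0 < r)%R & forall b, (a - r < b < a)%R ->
      (v - eta)%:E <= f b <= (v + eta)%:E) ->
  f b @[b --> a^'-] --> v%:E.
Proof.
move=> fv; apply: cvg_between => eta /fv[r r0 Hr].
near=> b; apply: Hr; apply/andP; split.
  by near: b; apply: nbhs_left_gt; rewrite ltrBlDr ltrDl.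
by near: b; exact: nbhs_left_lt.
Unshelve. all: by end_near. Qed.

Lemma cvg_at_right_between : (forall eta : R, (0 < eta)%R -> exists2 r : R,
    (0 < r)%R & forall b, (a < b < a + r)%R ->
      (v - eta)%:E <= f b <= (v + eta)%:E) ->
  f b @[b --> a^'+] --> v%:E.
Proof.
move=> fv; apply: cvg_between => eta /fv[r r0 Hr].
near=> b; apply: Hr; apply/andP; split.
  by near: b; exact: nbhs_right_gt.
by near: b; apply: nbhs_right_lt; rewrite ltrDl.
Unshelve. all: by end_near. Qed.

End one_sided_limits.

(** * Nearly optimal covers *)

Section near_optimal.
Context (d : measure_display) (X : measurableType d) (R : realType)
    (S : X -> X) (bijS : bijective S)
    (phi0 Lambda : {finite_measure set (A0 S) -> \bar R})
    (Lambda_inv : forall A : set (A0 S), measurable A ->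
       Lambda (S @^-1` A) = Lambda A)
    (Z : A0 S -> \bar R)
    (Z_ge0 : forall x, 0 <= Z x)
    (Z_meas : measurable_fun [set: A0 S] Z)
    (Z_density : forall A : set (A0 S), measurable A ->
       Lambda A = \int[phi0]_(x in A) Z x)
    (Q : set X) (BQ : sigma_B S Q).
Implicit Types (A : (set X)^nat) (b e : R).

Local Notation Phi := (outer S phi0 Q).
Local Notation Lam := (outer S Lambda Q).
Local Notation phis := (cover_sum S phi0).
Local Notation Lambdas := (cover_sum S Lambda).
Local Notation powsum b := (cover_sum S (pow_int phi0 Z b)).
Local Notation H_eps := (H_eps phi0 Z Q).
Local Notation H := (H phi0 Z Q).
Local Notation C0 := (C0 phi0 Q).
Local Notation C1 := (C1 Lambda Q).
Local Notation C01 := (C01 phi0 Lambda Q).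

Lemma measurable_pow b : measurable_fun [set: A0 S] (fun x => Z x `^ b).
Proof. exact: (measurableT_comp (measurable_poweR _) Z_meas). Qed.

Lemma finite_measure_lty (mu : {finite_measure set (A0 S) -> \bar R}) :
  mu setT < +oo.
Proof. by rewrite -ge0_fin_numE ?measure_ge0// fin_num_measure. Qed.

Lemma Phi_fin : Phi \is a fin_num.
Proof. exact: outer_fin_num (finite_measure_lty phi0). Qed.

Lemma Lam_fin : Lam \is a fin_num.
Proof. exact: outer_fin_num (finite_measure_lty Lambda). Qed.

Lemma LambdasE A : covers_measurable S A -> Lambdas A = wsum phi0 Z A.
Proof. by move=> mA; apply: eq_eseriesr => n _; rewrite Z_density//; exact: mA. Qed.

Lemma Phi_le A : covers S Q A -> Phi <= phis A.
Proof. by move=> cA; apply: ereal_inf_lbound; exists A. Qed.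

Lemma Lam_le A : covers S Q A -> Lam <= Lambdas A.
Proof. by move=> cA; apply: ereal_inf_lbound; exists A. Qed.

Lemma powsum_ge0 b A : 0 <= powsum b A.
Proof. by apply: (@wsum_ge0 _ _ _ _ phi0) => x; exact: poweR_ge0. Qed.

Lemma powsum_le b A : (0 < b <= 1)%R -> covers S Q A ->
  powsum b A <= phis A + Lambdas A.
Proof.
move=> bI /(covers_covers_measurable bijS) mA.
rewrite wsum1// LambdasE// -wsumD//.
apply: wsum_le => //.
- exact: measurable_pow.
- by move=> x; exact: poweR_ge0.
- exact: emeasurable_funD.
- by move=> x; exact: poweR_le_1D.
Qed.

Lemma C0_sub e e' : (e <= e')%R -> C0 e `<=` C0 e'.
Proof.
move=> ee' A [cA phiA]; split => //; apply: lt_le_trans phiA _.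
by rewrite leeD2l// lee_fin.
Qed.

Lemma C0_disjoint e A : C0 e A -> C0 e (disjoint_cover S A).
Proof.
move=> [cA phiA]; have cD := disjoint_cover_covers bijS cA.
split => //; apply: le_lt_trans phiA.
have mA := covers_covers_measurable bijS cA.
have mD := covers_covers_measurable bijS cD.
rewrite (wsum1 phi0 mA) (wsum1 phi0 mD).
by apply: (@wsum_disjoint_cover _ _ _ _ bijS phi0 _ Q) => // x; exact: lee01.
Qed.

Lemma C0_ex e : (0 < e)%R -> exists2 A, C0 e A & Lambdas A <= Lambda setT.
Proof.
move=> e0; have [_ [A cA <-] phiA] := lb_ereal_inf_adherent e0 Phi_fin.
exists (disjoint_cover S A); first exact: C0_disjoint.
exact: (cover_sum_disjoint_cover bijS Lambda_inv cA).
Qed.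

Lemma H_eps_anti b e e' : (e <= e')%R -> H_eps b e' <= H_eps b e.
Proof.
move=> /C0_sub sub; apply: ereal_inf_le_tmp => _ [A cA <-].
by exists A => //; exact: sub.
Qed.

Lemma H_eps_ge0 b e : 0 <= H_eps b e.
Proof. by apply: le_ereal_inf_tmp => _ [A _ <-]; exact: powsum_ge0. Qed.

Lemma H_cvg b :
  H_eps b e @[e --> 0^'+] --> ereal_sup (H_eps b @` [set` `]0%R, 1%R[]).
Proof.
apply: (nonincreasing_at_right_cvge (BLeft 1%R)) => [|x y _ _].
  by rewrite bnd_simp.
exact: H_eps_anti.
Qed.

Lemma HE b : H b = ereal_sup (H_eps b @` [set` `]0%R, 1%R[]).
Proof. by apply/cvg_lim => //; exact: H_cvg. Qed.

Lemma H_eps_le_H b e : (0 < e)%R -> H_eps b e <= H b.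
Proof.
move=> e0; rewrite HE.
apply: (@le_trans _ _ (H_eps b (Num.min e (1 / 2))%R)).
  by apply: H_eps_anti; rewrite ge_min lexx.
apply: ereal_sup_ubound; exists (Num.min e (1 / 2))%R => //=.
rewrite in_itv/= lt_min e0 gt_min; apply/andP; split; first by lra.
by apply/orP; right; lra.
Qed.

Lemma H_ge0 b : 0 <= H b.
Proof. by apply: le_trans (H_eps_le_H b ltr01); exact: H_eps_ge0. Qed.

(** Since z^b <= 1 + z, a disjoint cover that is optimal for phi0 gives a bound uniform in e. *)
Lemma H_fin b : (0 < b <= 1)%R -> H b \is a fin_num.
Proof.
move=> bI; rewrite ge0_fin_numE ?H_ge0// HE.
apply: (@le_lt_trans _ _ (Phi + 1 + Lambda setT)); last first.
  by rewrite !lte_add_pinfty ?ltry ?finite_measure_lty// ltey_eq Phi_fin.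
apply: ge_ereal_sup => _ [e /= + <-]; rewrite in_itv/= => /andP[e0 e1].
have [A [cA phiA] LA] := C0_ex e0.
apply: (@le_trans _ _ (powsum b A)); first by apply: ereal_inf_lbound; exists A.
apply: le_trans (powsum_le bI cA) _; apply: leeD => //.
by apply: le_trans (ltW phiA) _; rewrite leeD2l// lee_fin ltW.
Qed.

Lemma H_adherent b eta : (0 < b <= 1)%R -> (0 < eta)%R ->
  exists2 e, (0 < e < 1)%R & H b - eta%:E < H_eps b e.
Proof.
move=> bI eta0; have := H_fin bI; rewrite HE => Hf.
have [_ [e /= eI <-] lt] := ub_ereal_sup_adherent eta0 Hf.
by exists e => //; move: eI; rewrite in_itv.
Qed.

Lemma H_eps_adherent b e eta : (0 < b <= 1)%R -> (0 < e)%R -> (0 < eta)%R ->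
  exists2 A, C0 e A & powsum b A < H b + eta%:E.
Proof.
move=> bI e0 eta0; have : H_eps b e < H b + eta%:E.
  apply: le_lt_trans (H_eps_le_H b e0) _.
  by rewrite lteDl ?lte_fin// H_fin.
by move=> /ereal_inf_lt[_ [A cA <-]]; exists A.
Qed.

(* Penalization: a cover that is nearly optimal for phi0 + s Z^b phi0 + Lambda
   with s small is nearly optimal, lexicographically, for the three summands. *)
Lemma near_optimal_ex b e : (0 < b <= 1)%R -> (0 < e)%R ->
  exists A, [/\ C1 e A, C0 e A & powsum b A < H b + e%:E].
Proof.
move=> bI e0; have Hf := H_fin bI.
set hb := fine (H b); have hbE : H b = hb%:E by rewrite fineK.
have hb0 : (0 <= hb)%R by rewrite fine_ge0 ?H_ge0.
(* As s (hb + e) = e, the total will be below Phi + Lam + e, so phi0 and Lambda exceed their minima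
   by less than e; removing these minima and dividing by s leaves less than hb + e for the integrals
   of Z^b. *)
pose s := (e / (hb + e))%R.
have s0 : (0 < s)%R by rewrite divr_gt0// ltr_wpDl.
have se : (s * (hb + e) = e)%R by rewrite divfK// gt_eqF// ltr_wpDl.
pose f (x : A0 S) := 1 + s%:E * Z x `^ b.
have mpow := measurable_pow b.
have spow0 x : 0 <= s%:E * Z x `^ b by rewrite mule_ge0// ?poweR_ge0// lee_fin ltW.
have mspow : measurable_fun [set: A0 S] (fun x => s%:E * Z x `^ b).
  exact: measurable_funeM.
have mf : measurable_fun [set: A0 S] f by exact: emeasurable_funD.
have f0 x : 0 <= f x by rewrite adde_ge0.
pose psi : {measure set (A0 S) -> \bar R} := density_measure phi0 mf f0.
have psiE A : covers S Q A -> cover_sum S psi A = phis A + s%:E * powsum b A.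
  move=> /(covers_covers_measurable bijS) mA.
  rewrite wsum1// -[cover_sum S (pow_int _ _ _) A]/(wsum phi0 (fun x => Z x `^ b) A).
  rewrite -wsumZ//; [|by move=> x; exact: poweR_ge0|exact: ltW].
  by rewrite -wsumD.
have psi_fin : psi setT < +oo.
  rewrite [psi setT]/(\int[phi0]_(x in setT) f x).
  apply: (@le_lt_trans _ _ (\int[phi0]_(x in setT) (1 + s%:E * (1 + Z x)))).
    apply: ge0_le_integral => //.
      apply: emeasurable_funD => //; apply: measurable_funeM.
      exact: emeasurable_funD.
    move=> x _; rewrite leeD2l// lee_pmul2l//; exact: poweR_le_1D.
  rewrite ge0_integralD//; last 2 first.
  - by move=> x _; rewrite mule_ge0// ?adde_ge0// lee_fin ltW.
  - by apply: measurable_funeM; exact: emeasurable_funD.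
  rewrite ge0_integralZl_EFin//; last 3 first.
  - by move=> x _; rewrite adde_ge0.
  - exact: emeasurable_funD.
  - exact: ltW.
  rewrite ge0_integralD// -Z_density// integral_cst// mul1e.
  have := finite_measure_lty phi0; have := finite_measure_lty Lambda.
  move=> L P; rewrite lte_add_pinfty// lte_mul_pinfty ?lee_fin ?ltW//.
  by rewrite lte_add_pinfty.
have le_psi : outer S psi Q <= Phi + (s * hb)%:E.
  apply/lee_addgt0Pr => eta eta0.
  pose eta' := (eta / (1 + s))%R.
  have s1 : (0 < 1 + s)%R by rewrite addr_gt0.
  have eta'0 : (0 < eta')%R by rewrite divr_gt0.
  have [A [cA phiA] hA] := H_eps_adherent bI eta'0 eta'0.
  apply: (@le_trans _ _ (cover_sum S psi A)); first by apply: ereal_inf_lbound; exists A.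
  rewrite psiE//.
  have -> : Phi + (s * hb)%:E + eta%:E = (Phi + eta'%:E) + s%:E * (H b + eta'%:E).
    have eq1 : (fine Phi + s * hb + eta = fine Phi + eta' + s * (hb + eta'))%R.
      by rewrite /eta'; field; rewrite gt_eqF.
    by have := congr1 EFin eq1; rewrite !(EFinD, EFinM) hbE (fineK Phi_fin).
  apply: leeD; first exact: ltW.
  by rewrite lee_pmul2l// ltW.
have := outer_measure_add bijS Lambda_inv psi_fin (finite_measure_lty Lambda) BQ.
set psiL := measure_add psi Lambda => psiL_le.
have psiL_fin : outer S psiL Q \is a fin_num.
  rewrite ge0_fin_numE ?outer_ge0//; apply: le_lt_trans psiL_le _.
  by rewrite lte_add_pinfty// ltey_eq ?Lam_fin// outer_fin_num.
have se0 : (0 < s * e)%R by rewrite mulr_gt0.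
have [_ [A cA <-] ltA] := lb_ereal_inf_adherent se0 psiL_fin.
have psiLE : cover_sum S psiL A = phis A + s%:E * powsum b A + Lambdas A.
  rewrite -psiE// /cover_sum -nneseriesD//.
  by apply: eq_eseriesr => n _; exact: measure_addE.
have : phis A + s%:E * powsum b A + Lambdas A < (fine Phi + s * hb + fine Lam + s * e)%:E.
  rewrite -psiLE; apply: lt_le_trans ltA _.
  rewrite EFinD leeD2r//; apply: le_trans psiL_le _.
  by rewrite !EFinD (fineK Phi_fin) (fineK Lam_fin) leeD2r.
have := Phi_le cA; have := Lam_le cA; have := powsum_ge0 b A.
rewrite -{1}(fineK Phi_fin) -{1}(fineK Lam_fin).
have key p q r : 0 <= r -> (fine Lam)%:E <= q -> (fine Phi)%:E <= p ->
    p + s%:E * r + q < (fine Phi + s * hb + fine Lam + s * e)%:E ->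
    [/\ q < (fine Lam)%:E + e%:E, p < (fine Phi)%:E + e%:E & r < hb%:E + e%:E].
  case: r => [r| |]//; last by rewrite gt0_muley ?lte_fin//; case: p q => [p| |] [q| |].
  case: p q => [p| |] [q| |]//; rewrite -EFinM -!EFinD !lte_fin !lee_fin.
  move=> r0 Lq Pp lt.
  have sr : (s * r < s * (hb + e))%R by lra.
  have rlt : (r < hb + e)%R by rewrite -(ltr_pM2l s0).
  have sr0 : (0 <= s * r)%R by rewrite mulr_ge0// ltW.
  split => //; lra.
move=> r0 Lq Pp lt; have [] := key _ _ _ r0 Lq Pp lt.
rewrite (fineK Phi_fin) (fineK Lam_fin) -hbE => ? ? ?.
by exists A.
Qed.

Lemma C1_sub e e' : (e <= e')%R -> C1 e `<=` C1 e'.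
Proof.
move=> ee' A [cA LA]; split => //; apply: lt_le_trans LA _.
by rewrite leeD2l// lee_fin.
Qed.

Lemma inf_le_of_small (F : R -> set ((set X)^nat)) (f : (set X)^nat -> \bar R) v e :
    (forall e', (0 < e' <= e)%R -> F e' `<=` F e) -> (0 < e)%R ->
    (forall e', (0 < e')%R -> exists2 A, F e' A & f A < v + e'%:E) ->
  ereal_inf [set f A | A in F e] <= v.
Proof.
move=> sub e0 ex; apply/lee_addgt0Pr => eta eta0.
have m0 : (0 < Num.min e eta)%R by rewrite lt_min e0.
have [A FA fA] := ex _ m0.
apply: (@le_trans _ _ (f A)).
  apply: ereal_inf_lbound; exists A => //; apply: sub FA.
  by rewrite m0 ge_min lexx.
by apply: le_trans (ltW fA) _; rewrite leeD2l// lee_fin ge_min lexx orbT.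
Qed.

Lemma PhiLambdaE : PhiLambda phi0 Lambda Q = Phi.
Proof.
apply/cvg_lim => //; apply: cvg_near_cst; near=> e.
have e0 : (0 < e)%R by near: e; exact: nbhs_right_gt.
apply/eqP; rewrite eq_le; apply/andP; split; last first.
  by apply: le_ereal_inf_tmp => _ [A [cA _] <-]; exact: Phi_le.
apply: (@inf_le_of_small C1) => // [e' /andP[_ ?]|e' e'0]; first exact: C1_sub.
have I1 : (0 < (1 : R) <= 1)%R by rewrite ltr01 lexx.
by have [A [C1A [_ ?] _]] := near_optimal_ex I1 e'0; exists A.
Unshelve. all: by end_near. Qed.

Lemma C01P e A : C01 e A <-> C1 e A /\ C0 e A.
Proof.
rewrite /Defs.C01 /= PhiLambdaE.
by split => [[[cA ?] ?]|[? [_ ?]]].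
Qed.

Lemma C01_sub e e' : (e <= e')%R -> C01 e `<=` C01 e'.
Proof.
move=> ee' A /C01P[C1A C0A]; apply/C01P.
by split; [exact: C1_sub C1A|exact: C0_sub C0A].
Qed.

Lemma H01E b : (0 < b <= 1)%R -> H01 phi0 Lambda Z Q b = H b.
Proof.
move=> bI; apply/cvg_lim => //.
have Hc : H_eps b e @[e --> 0^'+] --> H b by rewrite HE; exact: H_cvg.
apply: (squeeze_cvge _ Hc (cvg_cst (H b))); near=> e.
have e0 : (0 < e)%R by near: e; exact: nbhs_right_gt.
apply/andP; split.
  apply: ereal_inf_le_tmp => _ [A /C01P[_ C0A] <-].
  by exists A.
apply: (@inf_le_of_small C01) => // [e' /andP[_ ?]|e' e'0]; first exact: C01_sub.
have [A [C1A C0A hA]] := near_optimal_ex bI e'0.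
by exists A; [apply/C01P; split; assumption|exact: hA].
Unshelve. all: by end_near. Qed.

Local Notation Cb01 := (Cb01 phi0 Lambda Z Q).
Local Notation C0H := (C0H phi0 Z Q).

Lemma Cb01P b e A : (0 < b <= 1)%R ->
  Cb01 b e A <-> C1 e A /\ C0H b e A.
Proof.
move=> bI; rewrite /Defs.Cb01 /= H01E//; split.
  by move=> [/C01P[? ?] ?].
move=> [C1A [C0A hA]]; split; [apply/C01P; split|]; assumption.
Qed.

Local Notation powlogsum b := (cover_sum S (powlog_int phi0 Z b)).

(** * Covers of bounded Lambda-sum as a convex family *)

Section interval.
Variables l u : R.
Implicit Types (x y w k p q : R).
Hypotheses (l0 : (0 < l)%R) (u1 : (u < 1)%R).

(** The shifted integrand is nonnegative for x >= l; the shift contributes l^-1 times the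
    phi0-sum. *)
Let pl x (t : A0 S) := powlog x (Z t) + (l^-1)%:E.

Let mpl x : measurable_fun [set: A0 S] (fun t => powlog x (Z t)).
Proof. exact: (measurableT_comp (measurable_powlog _) Z_meas). Qed.

Let mplC x : measurable_fun [set: A0 S] (pl x).
Proof. exact: emeasurable_funD. Qed.

Let pl0 x : (l <= x)%R -> forall t, 0 <= pl x t.
Proof. by move=> lx t; exact: powlog_ge. Qed.

Let lV0 : (0 <= l^-1 :> R)%R. Proof. by rewrite invr_ge0 ltW. Qed.

(** Relative to 1 + Z: the first term bounds Z^x log Z for x <= u, the second one is the shift. *)
Definition powlog_const := ((1 - u)^-1 + l^-1)%R.

Let plK0 : (0 <= powlog_const)%R.
Proof. by rewrite addr_ge0// invr_ge0 subr_ge0 ltW. Qed.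

Let pl_le x : (l <= x)%R -> (x <= u)%R ->
  forall t, pl x t <= powlog_const%:E * (1 + Z t).
Proof.
move=> lx xu t; have x0 := lt_le_trans l0 lx.
have Z1 : 0 <= 1 + Z t by rewrite adde_ge0.
rewrite EFinD ge0_muleDl ?lee_fin ?invr_ge0 ?subr_ge0 ?(ltW u1) ?(ltW l0)//.
apply: leeD; first exact: powlog_le.
by rewrite -[X in X <= _]mule1; apply: lee_pmul => //; rewrite leeDl.
Qed.

Let m1Z k : measurable_fun [set: A0 S] (fun t => k%:E * (1 + Z t)).
Proof. by apply: measurable_funeM; exact: emeasurable_funD. Qed.

Let int_pl x : (l <= x)%R -> (x <= u)%R -> \int[phi0]_t pl x t < +oo.
Proof.
move=> lx xu.
apply: (@le_lt_trans _ _ (\int[phi0]_t (powlog_const%:E * (1 + Z t)))).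
  by apply: ge0_le_integral => // t _; [exact: pl0|exact: pl_le].
rewrite ge0_integralZl_EFin//; last 2 first.
- by move=> t _; rewrite adde_ge0.
- exact: emeasurable_funD.
rewrite ge0_integralD// -Z_density// integral_cst// mul1e.
have := finite_measure_lty phi0; have := finite_measure_lty Lambda => LT PT.
by rewrite lte_mul_pinfty ?lee_fin// lte_add_pinfty.
Qed.

Lemma powlogsumE x A : covers S Q A -> phis A < +oo -> (l <= x <= u)%R ->
  powlogsum x A = wsum phi0 (pl x) A - (l^-1)%:E * phis A.
Proof.
move=> /(covers_covers_measurable bijS) mA pA /andP[lx xu].
apply: wsum_signed => //; [exact: mpl|exact: pl0|exact: int_pl].
Qed.

Lemma wsum1Z k A : covers S Q A -> (0 <= k)%R ->
  wsum phi0 (fun t => k%:E * (1 + Z t)) A = k%:E * (phis A + Lambdas A).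
Proof.
move=> /(covers_covers_measurable bijS) mA k0.
rewrite wsumZ//; last 2 first.
- exact: emeasurable_funD.
- by move=> t; rewrite adde_ge0.
by rewrite wsumD// -wsum1// LambdasE.
Qed.

Definition bounded_covers e : set ((set X)^nat) :=
  [set A | C0 e A /\ Lambdas A <= Lambda setT + 1].

(** Bounds the sum of the integrals of 1 + Z over a cover in [bounded_covers 1]. *)
Definition mass_bound : R := (fine Phi + 1 + (fine (Lambda setT) + 1))%R.

Let Lambda_fin : Lambda setT \is a fin_num.
Proof. by rewrite ge0_fin_numE ?finite_measure_lty. Qed.

Lemma bounded_coversP A : bounded_covers 1%R A -> exists p q : R,
  [/\ phis A = p%:E, Lambdas A = q%:E, (0 <= p)%R, (0 <= q)%R &
      (p + q <= mass_bound)%R].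
Proof.
move=> [[cA pA] LA].
have p0 : 0 <= phis A by exact: nneseries_ge0.
have q0 : 0 <= Lambdas A by exact: nneseries_ge0.
have pf : phis A \is a fin_num.
  rewrite ge0_fin_numE//; apply: lt_le_trans pA _.
  by rewrite leey.
have qf : Lambdas A \is a fin_num.
  rewrite ge0_fin_numE//; apply: le_lt_trans LA _.
  by rewrite lte_add_pinfty ?finite_measure_lty// ltry.
exists (fine (phis A)), (fine (Lambdas A)); rewrite !fineK//.
split => //; rewrite ?fine_ge0//.
move: pA LA; rewrite -(fineK pf) -(fineK qf) -(fineK Phi_fin) -(fineK Lambda_fin).
by rewrite -!EFinD lte_fin lee_fin /mass_bound => ? ?; lra.
Qed.

Lemma covers_bounded A e : bounded_covers e A -> covers S Q A.
Proof. by move=> [[]]. Qed.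

Definition powv x A := fine (powsum x A).
Definition powlogv x A := fine (powlogsum x A).

Lemma powvE x A : bounded_covers 1%R A -> (l <= x <= u)%R ->
  powsum x A = (powv x A)%:E.
Proof.
move=> DA /andP[lx xu]; rewrite /powv fineK// ge0_fin_numE ?powsum_ge0//.
have [p [q [pE qE _ _ _]]] := bounded_coversP DA.
apply: le_lt_trans (powsum_le _ (covers_bounded DA)) _.
  by rewrite (lt_le_trans l0 lx)/= (le_trans xu)// ltW.
by rewrite pE qE -EFinD ltry.
Qed.

Lemma powlogvE x A p : bounded_covers 1%R A -> (l <= x <= u)%R -> phis A = p%:E ->
  powlogsum x A = (powlogv x A)%:E /\
  wsum phi0 (pl x) A = (powlogv x A + l^-1 * p)%:E.
Proof.
move=> DA /andP[lx xu] pE; have cA := covers_bounded DA.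
have [p' [q [p'E qE _ _ _]]] := bounded_coversP DA.
have wf : wsum phi0 (pl x) A \is a fin_num.
  rewrite ge0_fin_numE; last by apply: wsum_ge0; exact: pl0.
  apply: (@le_lt_trans _ _ (wsum phi0 (fun t => powlog_const%:E * (1 + Z t)) A)).
    apply: wsum_le; [exact: covers_covers_measurable cA|exact: mplC|exact: pl0
                    |exact: m1Z|exact: pl_le].
  by rewrite wsum1Z// p'E qE -EFinD -EFinM ltry.
have plE := powlogsumE cA (_ : phis A < +oo) (_ : (l <= x <= u)%R).
rewrite pE ltry lx xu in plE; rewrite /powlogv (plE isT isT) -(fineK wf).
by rewrite -EFinM -EFinD; split => //; rewrite EFinD /= subrK.
Qed.

Definition lipschitz_const : R := (4 / (1 - u) ^+ 2 + 4 / l ^+ 2)%R.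

Let I x : (l <= x)%R -> (x <= u)%R -> (0 < x <= 1)%R.
Proof.
by move=> lx xu; rewrite (lt_le_trans l0 lx)/= (le_trans xu)// ltW.
Qed.

Let M0 : (0 <= mass_bound)%R.
Proof.
by rewrite !addr_ge0// fine_ge0// outer_ge0.
Qed.

Let K10 : (0 <= lipschitz_const)%R.
Proof.
by rewrite addr_ge0// divr_ge0// sqr_ge0.
Qed.

Let mP x : measurable_fun [set: A0 S] (fun t => Z t `^ x).
Proof. exact: measurable_pow. Qed.

Let P0 x (t : A0 S) : 0 <= Z t `^ x.
Proof.
by exact: poweR_ge0.
Qed.

Let DC e A : bounded_covers e A -> covers_measurable S A.
Proof.
by move=> /covers_bounded; exact: covers_covers_measurable.
Qed.

Let cst_sum k A p : bounded_covers 1%R A -> phis A = p%:E -> (0 <= k)%R ->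
    wsum phi0 (cst k%:E) A = (k * p)%:E.
Proof.
move=> DA pE k0; rewrite EFinM -pE -nneseriesZl//.
by apply: eq_eseriesr => n _; rewrite integral_cst//; exact: (DC DA).
Qed.

Let k0 x y : (x <= y)%R -> (0 <= y - x)%R.
Proof.
by rewrite subr_ge0.
Qed.

Let pdl k x w A p : bounded_covers 1%R A -> (l <= x <= u)%R -> (l <= w <= u)%R ->
    (0 <= k)%R -> phis A = p%:E ->
    wsum phi0 (fun t => k%:E * pl x t + Z t `^ w) A =
      (k * (powlogv x A + l^-1 * p) + powv w A)%:E.
Proof.
move=> DA xI wI kp pE; have mA := DC DA.
have lx : (l <= x)%R by case/andP: xI.
rewrite wsumD//; last 2 first.
- by apply: measurable_funeM; exact: mplC.
- by move=> t; rewrite mule_ge0// ?pl0// lee_fin.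
rewrite wsumZ//; last exact: pl0.
by rewrite (powlogvE DA xI pE).2 [X in _ + X](powvE DA wI).
Qed.

Let pcst k w A p : bounded_covers 1%R A -> (l <= w <= u)%R ->
    (0 <= k)%R -> phis A = p%:E ->
    wsum phi0 (fun t => Z t `^ w + k%:E) A = (powv w A + k * p)%:E.
Proof.
move=> DA wI kp pE; have mA := DC DA.
rewrite (@wsumD _ _ _ _ phi0 _ (cst k%:E))//.
by rewrite (cst_sum DA pE kp) [X in X + _](powvE DA wI).
Qed.

Let mpdl k x w : measurable_fun [set: A0 S] (fun t => k%:E * pl x t + Z t `^ w).
Proof.
by apply: emeasurable_funD => //; apply: measurable_funeM; exact: mplC.
Qed.

Let mpcst k w : measurable_fun [set: A0 S] (fun t => Z t `^ w + k%:E).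
Proof.
exact: emeasurable_funD.
Qed.

Let D_mono (e e' : R) : (0 < e)%R -> (e <= e')%R -> (e' <= 1)%R ->
  bounded_covers e `<=` bounded_covers e'.
Proof.
move=> e0 ee' _ A [C0A LA]; split => //; exact: C0_sub C0A.
Qed.

Let K0 : (0 <= (lipschitz_const + powlog_const) * mass_bound)%R.
Proof.
by rewrite mulr_ge0// addr_ge0.
Qed.

(** [powlog_lower] is integrated with C = l^-1; the shift contributes (y - x) l^-1 p to both sides
    and cancels. *)
Let conv_lower x y A : bounded_covers 1%R A -> (l <= x)%R -> (x <= y)%R -> (y <= u)%R ->
  ((y - x) * powlogv x A <= powv y A - powv x A)%R.
Proof.
move=> DA lx xy yu; have [p [q [pE qE p0 q0 pq]]] := bounded_coversP DA.
have xI : (l <= x <= u)%R by rewrite lx (le_trans xy).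
have yI : (l <= y <= u)%R by rewrite yu (le_trans lx).
have := @wsum_le _ _ _ S phi0 (fun t => (y - x)%:E * pl x t + Z t `^ x)
  (fun t => Z t `^ y + ((y - x) * l^-1)%:E) A (DC DA).
rewrite (pdl DA xI xI (k0 xy) pE).
rewrite (pcst DA yI (mulr_ge0 (k0 xy) lV0) pE).
rewrite lee_fin => /(_ (mpdl _ _ _)); suff le_fun : [/\
  forall t, 0 <= (y - x)%:E * pl x t + Z t `^ x &
  forall t, (y - x)%:E * pl x t + Z t `^ x <= Z t `^ y + ((y - x) * l^-1)%:E].
  by move=> /(_ le_fun.1 (mpcst _ _) le_fun.2); lra.
split=> t; first by rewrite adde_ge0// mule_ge0// ?pl0// lee_fin k0.
by apply: powlog_lower => //; exact: lt_le_trans lx.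
Qed.

Let conv_upper x y A : bounded_covers 1%R A -> (l <= x)%R -> (x <= y)%R -> (y <= u)%R ->
  (powv y A - powv x A <= (y - x) * powlogv y A)%R.
Proof.
move=> DA lx xy yu; have [p [q [pE qE p0 q0 pq]]] := bounded_coversP DA.
have xI : (l <= x <= u)%R by rewrite lx (le_trans xy).
have yI : (l <= y <= u)%R by rewrite yu (le_trans lx).
have := @wsum_le _ _ _ S phi0 (fun t => Z t `^ y + ((y - x) * l^-1)%:E)
  (fun t => (y - x)%:E * pl y t + Z t `^ x) A (DC DA).
rewrite (pdl DA yI xI (k0 xy) pE).
rewrite (pcst DA yI (mulr_ge0 (k0 xy) lV0) pE).
rewrite lee_fin => /(_ (mpcst _ _)); suff le_fun : [/\
  forall t, 0 <= Z t `^ y + ((y - x) * l^-1)%:E &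
  forall t, Z t `^ y + ((y - x) * l^-1)%:E <= (y - x)%:E * pl y t + Z t `^ x].
  by move=> /(_ le_fun.1 (mpdl _ _ _) le_fun.2); lra.
split=> t; first by rewrite adde_ge0// lee_fin mulr_ge0// k0.
by rewrite addeC [leRHS]addeC addeC; apply: powlog_upper => //; exact: lt_le_trans lx.
Qed.

Let slope_mono x y A : bounded_covers 1%R A -> (l <= x)%R -> (x <= y)%R -> (y <= u)%R ->
  (powlogv x A <= powlogv y A)%R.
Proof.
move=> DA lx xy yu; have [p [q [pE qE p0 q0 pq]]] := bounded_coversP DA.
have xI : (l <= x <= u)%R by rewrite lx (le_trans xy).
have yI : (l <= y <= u)%R by rewrite yu (le_trans lx).
have : wsum phi0 (pl x) A <= wsum phi0 (pl y) A.
  apply: wsum_le; [exact: DC DA|exact: mplC|exact: pl0|exact: mplC|move=> t].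
  by rewrite leeD2r// powlog_mono//; exact: lt_le_trans lx.
by rewrite (powlogvE DA xI pE).2 (powlogvE DA yI pE).2 lee_fin lerD2r.
Qed.

Let slope_lip x y A : bounded_covers 1%R A -> (l <= x)%R -> (x <= y)%R -> (y <= u)%R ->
  (powlogv y A <= powlogv x A +
     (lipschitz_const + powlog_const) * mass_bound * (y - x))%R.
Proof.
move=> DA lx xy yu; have [p [q [pE qE p0 q0 pq]]] := bounded_coversP DA.
have xI : (l <= x <= u)%R by rewrite lx (le_trans xy).
have yI : (l <= y <= u)%R by rewrite yu (le_trans lx).
have kp : (0 <= lipschitz_const * (y - x))%R by rewrite mulr_ge0// k0.
have m1 := m1Z (lipschitz_const * (y - x)).
have p1 (t : A0 S) : 0 <= (lipschitz_const * (y - x))%:E * (1 + Z t).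
  by rewrite mule_ge0// ?lee_fin// adde_ge0.
have : wsum phi0 (pl y) A <= wsum phi0
    (fun t => pl x t + (lipschitz_const * (y - x))%:E * (1 + Z t)) A.
  apply: wsum_le; [exact: DC DA|exact: mplC|apply: pl0| |move=> t].
  - exact: le_trans xy.
  - by apply: emeasurable_funD => //; exact: mplC.
  - rewrite /pl -addeA [X in _ <= _ + X]addeC addeA leeD2r//; exact: powlog_lip.
rewrite (@wsumD _ _ _ S phi0 (pl x) _ A)//; try by [exact: (DC DA)|exact: mplC|exact: pl0].
rewrite wsum1Z//; last exact: covers_bounded DA.
rewrite (powlogvE DA xI pE).2 (powlogvE DA yI pE).2 pE qE.
rewrite -(EFinD p q) -EFinM -EFinD lee_fin => le1.
move: le1; move: (powlogv x A) (powlogv y A) => Lx Ly le1.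
have := ler_wpM2l kp pq; have : (0 <= powlog_const * mass_bound * (y - x))%R.
  by rewrite !mulr_ge0// k0.
lra.
Qed.

Let slope_bound x A : bounded_covers 1%R A -> (l <= x <= u)%R ->
  (`|powlogv x A| <= (lipschitz_const + powlog_const) * mass_bound)%R.
Proof.
move=> DA /andP[lx xu]; have [p [q [pE qE p0 q0 pq]]] := bounded_coversP DA.
have xI : (l <= x <= u)%R by rewrite lx.
have : wsum phi0 (pl x) A <= wsum phi0 (fun t => powlog_const%:E * (1 + Z t)) A.
  by apply: wsum_le; [exact: DC DA|exact: mplC|exact: pl0|exact: m1Z|exact: pl_le].
have : 0 <= wsum phi0 (pl x) A by apply: wsum_ge0; exact: pl0.
rewrite wsum1Z//; last exact: covers_bounded DA.
rewrite (powlogvE DA xI pE).2 pE qE -EFinD -EFinM !lee_fin => le0 le1.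
have := ler_wpM2l plK0 pq.
have : (0 <= lipschitz_const * mass_bound)%R by rewrite mulr_ge0.
have : (l^-1 * p <= powlog_const * mass_bound)%R.
  apply: ler_pM => //; last by lra.
  by rewrite lerDr invr_ge0 subr_ge0 ltW.
have : (0 <= l^-1 * p)%R by rewrite mulr_ge0.
rewrite ler_norml; move=> *; apply/andP; split; lra.
Qed.

Let inf_bound x eta : (l <= x <= u)%R -> (0 < eta)%R ->
  exists2 e, (0 < e <= 1)%R &
    forall A, bounded_covers e A -> (fine (H x) - eta <= powv x A)%R.
Proof.
move=> /andP[lx xu] eta0; have xI : (l <= x <= u)%R by rewrite lx.
have [e /andP[e0 e1] He] := H_adherent (I lx xu) eta0.
exists e; first by rewrite e0 ltW.
move=> A [C0A LA]; have DA : bounded_covers 1%R A.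
  by split => //; apply: C0_sub C0A; exact: ltW.
rewrite -lee_fin EFinB -(powvE DA xI) fineK ?H_fin ?I//.
by apply: le_trans (ltW He) _; apply: ereal_inf_lbound; exists A.
Qed.

Let inf_ex x e : (l <= x <= u)%R -> (0 < e <= 1)%R ->
  exists2 A, bounded_covers e A & (powv x A < fine (H x) + e)%R.
Proof.
move=> /andP[lx xu] /andP[e0 e1]; have xI : (l <= x <= u)%R by rewrite lx.
have [A [[cA LA] C0A hA]] := near_optimal_ex (I lx xu) e0.
have DA : bounded_covers e A.
  split => //; apply: le_trans (ltW LA) _; apply: leeD; last by rewrite lee_fin.
  exact: le_trans (outer_subset bijS _ (@subsetT _ Q)) (outer_leT bijS _ _).
exists A => //; rewrite -lte_fin EFinD (fineK (H_fin (I lx xu))).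
have D1A : bounded_covers 1%R A by split; [exact: C0_sub C0A|exact: DA.2].
by rewrite -(powvE D1A xI).
Qed.

(** The record has a single constant K, here the sum of one that suffices for [cf_lip] and another
    used for [cf_bound]. *)
Lemma bounded_covers_convex :
  convex_family bounded_covers powv powlogv (fun x => fine (H x)) l u
    ((lipschitz_const + powlog_const) * mass_bound)%R.
Proof.
split; [exact: D_mono|exact: K0|exact: conv_lower|exact: conv_upper
       |exact: slope_mono|exact: slope_lip|exact: slope_bound|exact: inf_bound
       |exact: inf_ex].
Qed.

Local Notation near_opt :=
  (near_opt bounded_covers powv (fun x => fine (H x))).

Lemma near_optP b e A : (l <= b <= u)%R -> (0 < e <= 1)%R ->
  near_opt b e A <-> C0H b e A /\ Lambdas A <= Lambda setT + 1.
Proof.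
move=> bI /andP[e0 e1]; have bI' : (0 < b <= 1)%R by case/andP: bI; exact: I.
split=> [[[C0A LA] hA]|[[C0A hA] LA]].
  have D1A : bounded_covers 1%R A by split => //; exact: C0_sub C0A.
  split=> //; split=> //; rewrite (powvE D1A bI).
  by rewrite -(fineK (H_fin bI')) -EFinD lte_fin.
have D1A : bounded_covers 1%R A by split => //; exact: C0_sub C0A.
split; first by split.
by rewrite -lte_fin EFinD (fineK (H_fin bI')) -(powvE D1A bI).
Qed.

Lemma Cb01_near_opt b e A : (l <= b <= u)%R -> (0 < e <= 1)%R ->
  Cb01 b e A -> near_opt b e A.
Proof.
move=> bI eI; have bI' : (0 < b <= 1)%R by case/andP: bI; exact: I.
move=> /(Cb01P _ _ bI')[[_ LA] C0HA]; apply/near_optP => //; split => //.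
apply: le_trans (ltW LA) _; apply: leeD; last by rewrite lee_fin; case/andP: eI.
exact: le_trans (outer_subset bijS _ (@subsetT _ Q)) (outer_leT bijS _ _).
Qed.

Lemma Cb01_ex b e : (0 < b <= 1)%R -> (0 < e)%R -> Cb01 b e !=set0.
Proof.
move=> bI e0; have [A [C1A C0A hA]] := near_optimal_ex bI e0.
by exists A; apply/Cb01P; [exact: bI|split; [exact: C1A|split; [exact: C0A|exact: hA]]].
Qed.

(** The Lambda-constraint does not involve the exponent, so it is inherited from b. *)
Lemma Cb01_near_opt_trans a b e e' A : (l <= a <= u)%R -> (l <= b <= u)%R ->
  (0 < e)%R -> (e <= e')%R -> (e' <= 1)%R ->
  Cb01 b e A -> near_opt a e' A -> Cb01 a e' A.
Proof.
move=> aI bI e0 ee' e'1.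
have aI' : (0 < a <= 1)%R by case/andP: aI; exact: I.
have bI' : (0 < b <= 1)%R by case/andP: bI; exact: I.
have e'I : (0 < e' <= 1)%R by rewrite (lt_le_trans e0).
move=> /(Cb01P _ _ bI')[C1A _] /(near_optP _ aI e'I)[C0HA _].
by apply/(Cb01P _ _ aI'); split; [exact: C1_sub C1A|exact: C0HA].
Qed.

(* The overlaps of a nearly optimal cover have small mass, so the negative part
   of Z^c log Z contributes little there. *)
Lemma C0H_disjoint b c e A : (l <= b <= u)%R -> (l <= c <= u)%R ->
    (0 < e <= 1)%R -> C0H b e A -> exists2 A', near_opt b e A' &
    (powlogv c A' - l^-1 * e)%:E <= powlogsum c A.
Proof.
move=> bI cI eI [C0A hA]; have [cA pA] := C0A.
have cA' := disjoint_cover_covers bijS cA.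
have mA := covers_covers_measurable bijS cA.
have mA' := covers_covers_measurable bijS cA'.
have nA' : near_opt b e (disjoint_cover S A).
  apply/near_optP => //; split; last first.
    apply: le_trans (cover_sum_disjoint_cover bijS Lambda_inv cA) _.
    by rewrite leeDl.
  split; first exact: C0_disjoint.
  apply: le_lt_trans hA; apply: (wsum_disjoint_cover bijS _ cA).
    exact: measurable_pow.
  by move=> t; exact: poweR_ge0.
exists (disjoint_cover S A) => //.
have D1A' : bounded_covers 1%R (disjoint_cover S A).
  by case: nA' => -[C0A' LA'] _; split => //; apply: C0_sub C0A'; case/andP: eI.
have [p' [q' [p'E _ _ _ _]]] := bounded_coversP D1A'.
have Phip' := Phi_le cA'.
have pfin : phis A \is a fin_num.
  by rewrite ge0_fin_numE ?nneseries_ge0//; apply: lt_le_trans pA _; rewrite leey.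
have pAoo : phis A < +oo by rewrite -ge0_fin_numE ?nneseries_ge0.
rewrite (powlogsumE cA pAoo cI).
have le_pl : wsum phi0 (pl c) (disjoint_cover S A) <= wsum phi0 (pl c) A.
  apply: (wsum_disjoint_cover bijS _ cA); first exact: mplC.
  by apply: pl0; case/andP: cI.
apply: (@le_trans _ _ (wsum phi0 (pl c) (disjoint_cover S A) - (l^-1)%:E * phis A));
  last by rewrite leeD2r.
rewrite (powlogvE D1A' cI p'E).2; move: pA Phip'; rewrite p'E.
rewrite -(fineK pfin) -(fineK Phi_fin) -EFinM -!EFinD lte_fin !lee_fin => pA Phip'.
have : (l^-1 * (fine (phis A) - p' - e) <= 0)%R.
  by rewrite mulr_ge0_le0//; lra.
lra.
Qed.

(** * Bounds for Xi and Psi from the slopes of nearly optimal covers *)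

Local Notation Xi_eps := (Xi_eps phi0 Lambda Z Q).
Local Notation Psi_eps := (Psi_eps phi0 Z Q).
Local Notation Xi := (Xi phi0 Lambda Z Q).
Local Notation Psi := (Psi phi0 Z Q).
Local Notation delta := (delta phi0 Z Q).
Local Notation eps' := (eps' phi0 Lambda Z Q).

Definition slope_const : R := ((lipschitz_const + powlog_const) * mass_bound)%R.

Let cf : convex_family bounded_covers powv powlogv (fun x => fine (H x)) l u
  slope_const.
Proof. exact: bounded_covers_convex. Qed.

Let powlogsum_near b c (e : R) A : (0 < e <= 1)%R -> (l <= c <= u)%R ->
  near_opt b e A -> powlogsum c A = (powlogv c A)%:E.
Proof.
move=> eI cI nA; have D1A := cf_D1 cf eI nA.1.
have [p [q [pE _ _ _ _]]] := bounded_coversP D1A.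
by have [] := powlogvE D1A cI pE.
Qed.

Lemma Xi_eps_le b c (e v : R) : (l <= b <= u)%R -> (l <= c <= u)%R -> (0 < e <= 1)%R ->
  (forall A, Cb01 b e A -> (powlogv c A <= v)%R) -> Xi_eps c b e <= v%:E.
Proof.
move=> bI cI eI vA; apply: ge_ereal_sup => _ [A cA <-].
by rewrite (powlogsum_near eI cI (Cb01_near_opt bI eI cA)) lee_fin vA.
Qed.

Lemma Xi_eps_ge b c (e : R) A : (l <= b <= u)%R -> (l <= c <= u)%R -> (0 < e <= 1)%R ->
  Cb01 b e A -> (powlogv c A)%:E <= Xi_eps c b e.
Proof.
move=> bI cI eI cA; apply: ereal_sup_ubound; exists A => //.
by rewrite (powlogsum_near eI cI (Cb01_near_opt bI eI cA)).
Qed.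

(** The infimum also runs over covers of large Lambda-sum; making them disjoint costs l^-1 e. *)
Lemma Psi_eps_ge b c (e v : R) : (l <= b <= u)%R -> (l <= c <= u)%R -> (0 < e <= 1)%R ->
  (forall A, near_opt b e A -> (v <= powlogv c A)%R) ->
  (v - l^-1 * e)%:E <= Psi_eps c b e.
Proof.
move=> bI cI eI vA; apply: le_ereal_inf_tmp => _ [A cA <-].
have [A' nA'] := C0H_disjoint bI cI eI cA; apply: le_trans.
by rewrite lee_fin lerD2r vA.
Qed.

Lemma Psi_eps_le b c (e : R) A : (l <= b <= u)%R -> (l <= c <= u)%R -> (0 < e <= 1)%R ->
  near_opt b e A -> Psi_eps c b e <= (powlogv c A)%:E.
Proof.
move=> bI cI eI nA; apply: ereal_inf_lbound; exists A.
  by have [] := (near_optP A bI eI).1 nA.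
exact: powlogsum_near eI cI nA.
Qed.

Lemma C0H_sub b (e e' : R) : (e <= e')%R -> C0H b e `<=` C0H b e'.
Proof.
move=> ee' A [C0A hA]; split; first exact: C0_sub C0A.
by apply: lt_le_trans hA _; rewrite leeD2l// lee_fin.
Qed.

Lemma Xi_eps_mono b c (e e' : R) : (l <= b <= u)%R -> (e <= e')%R ->
  Xi_eps c b e <= Xi_eps c b e'.
Proof.
move=> bI ee'; have bI' : (0 < b <= 1)%R by case/andP: bI; exact: I.
apply: ereal_sup_le => _ [A /(Cb01P _ _ bI')[C1A C0HA] <-]; exists A => //.
by apply/(Cb01P _ _ bI'); split; [exact: C1_sub C1A|exact: C0H_sub C0HA].
Qed.

Lemma Psi_eps_anti b c (e e' : R) : (e <= e')%R -> Psi_eps c b e' <= Psi_eps c b e.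
Proof.
move=> ee'; apply: ereal_inf_le_tmp => _ [A cA <-].
by exists A => //; exact: C0H_sub cA.
Qed.

Lemma XiE b c : (l <= b <= u)%R ->
  Xi c b = ereal_inf (Xi_eps c b @` [set` `]0%R, 1%R[]).
Proof.
move=> bI; apply/cvg_lim => //.
apply: (nondecreasing_at_right_cvge (BLeft 1%R)) => [|x y _ _].
  by rewrite bnd_simp.
exact: Xi_eps_mono.
Qed.

Lemma PsiE b c : Psi c b = ereal_sup (Psi_eps c b @` [set` `]0%R, 1%R[]).
Proof.
apply/cvg_lim => //.
apply: (nonincreasing_at_right_cvge (BLeft 1%R)) => [|x y _ _].
  by rewrite bnd_simp.
exact: Psi_eps_anti.
Qed.

Let half_min (e : R) : (0 < e)%R -> (Num.min e (1 / 2) \in `]0, 1[)%R.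
Proof.
move=> e0; rewrite in_itv/= lt_min e0 gt_min; apply/andP; split; first by lra.
by apply/orP; right; lra.
Qed.

Lemma Xi_le_eps b c (e : R) : (l <= b <= u)%R -> (0 < e)%R -> Xi c b <= Xi_eps c b e.
Proof.
move=> bI e0; rewrite XiE//.
apply: (@le_trans _ _ (Xi_eps c b (Num.min e (1 / 2))%R)).
  by apply: ereal_inf_lbound; exists (Num.min e (1 / 2))%R => //=; exact: half_min.
by apply: Xi_eps_mono => //; rewrite ge_min lexx.
Qed.

Lemma Xi_ge b c v : (l <= b <= u)%R ->
  (forall e : R, (0 < e < 1)%R -> v <= Xi_eps c b e) -> v <= Xi c b.
Proof.
move=> bI ve; rewrite XiE//; apply: le_ereal_inf_tmp => _ [e /= + <-].
by rewrite in_itv; exact: ve.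
Qed.

Lemma Psi_ge_eps b c (e : R) : (0 < e)%R -> Psi_eps c b e <= Psi c b.
Proof.
move=> e0; rewrite PsiE.
apply: (@le_trans _ _ (Psi_eps c b (Num.min e (1 / 2))%R)).
  by apply: Psi_eps_anti; rewrite ge_min lexx.
by apply: ereal_sup_ubound; exists (Num.min e (1 / 2))%R => //=; exact: half_min.
Qed.

Lemma Psi_le b c v : (forall e : R, (0 < e < 1)%R -> Psi_eps c b e <= v) -> Psi c b <= v.
Proof.
move=> ve; rewrite PsiE; apply: ge_ereal_sup => _ [e /= + <-].
by rewrite in_itv; exact: ve.
Qed.

(** Lower bounds for Xi and upper bounds for Psi need a nearly optimal cover at every small level,
    hence the hypothesis for all e <= e0. The loss l^-1 e0 occurs only in the lower bounds for
    Psi. *)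
Lemma slopes_within b c (e0 lo hi : R) : (l <= b <= u)%R -> (l <= c <= u)%R ->
    (0 < e0 <= 1)%R ->
    (forall e A, (0 < e <= e0)%R -> near_opt b e A -> (lo <= powlogv c A <= hi)%R) ->
  [/\ lo%:E <= Xi_eps c b e0 <= hi%:E, lo%:E <= Xi c b <= hi%:E,
      (lo - l^-1 * e0)%:E <= Psi_eps c b e0 <= hi%:E &
      (lo - l^-1 * e0)%:E <= Psi c b <= hi%:E].
Proof.
move=> bI cI e0I within; have [e00 e01] := andP e0I.
have bI' : (0 < b <= 1)%R by case/andP: bI; exact: I.
have e0e0 : (0 < e0 <= e0)%R by rewrite e00 lexx.
have Xlo e : (0 < e <= e0)%R -> lo%:E <= Xi_eps c b e.
  move=> /andP[ep ee0]; have eI : (0 < e <= 1)%R by rewrite ep (le_trans ee0).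
  have [A cA] := Cb01_ex bI' ep.
  apply: le_trans (Xi_eps_ge bI cI eI cA); rewrite lee_fin.
  by have /andP[] := within e A (introT andP (conj ep ee0)) (Cb01_near_opt bI eI cA).
have Xhi : Xi_eps c b e0 <= hi%:E.
  apply: Xi_eps_le => // A /(Cb01_near_opt bI e0I) nA.
  by have /andP[] := within _ _ e0e0 nA.
have Plo : (lo - l^-1 * e0)%:E <= Psi_eps c b e0.
  by apply: Psi_eps_ge => // A nA; have /andP[] := within _ _ e0e0 nA.
have Phi_hi e : (0 < e <= e0)%R -> Psi_eps c b e <= hi%:E.
  move=> /andP[ep ee0]; have eI : (0 < e <= 1)%R by rewrite ep (le_trans ee0).
  have [A nA] := near_opt_ex cf bI eI.
  apply: le_trans (Psi_eps_le bI cI eI nA) _; rewrite lee_fin.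
  by have /andP[] := within e A (introT andP (conj ep ee0)) nA.
have mI e : (0 < e)%R -> (0 < Num.min e e0 <= e0)%R.
  by move=> ep; rewrite lt_min ep e00 ge_min lexx orbT.
split; apply/andP; split=> //.
- exact: Xlo.
- apply: Xi_ge => // e /andP[ep _]; apply: le_trans (Xlo _ (mI _ ep)) _.
  by apply: Xi_eps_mono => //; rewrite ge_min lexx.
- exact: le_trans (Xi_le_eps _ bI e00) Xhi.
- exact: Phi_hi.
- exact: le_trans Plo (Psi_ge_eps _ _ e00).
- apply: Psi_le => e /andP[ep _]; apply: le_trans (Phi_hi _ (mI _ ep)).
  by apply: Psi_eps_anti; rewrite ge_min lexx.
Qed.

Lemma powR_small (tau eta : R) : (0 < tau)%R -> (0 < eta)%R ->
  exists2 r : R, (0 < r <= 1)%R & forall x, (0 <= x < r)%R -> (x `^ tau <= eta)%R.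
Proof.
move=> tau0 eta0; have r0 : (0 < eta `^ tau^-1)%R by exact: powR_gt0.
exists (Num.min 1 (eta `^ tau^-1))%R; first by rewrite lt_min ltr01 r0 ge_min lexx.
move=> x /andP[x0]; rewrite lt_min => /andP[_ xr].
have -> : (eta = (eta `^ tau^-1) `^ tau)%R.
  by rewrite -powRrM mulVf ?gt_eqF// powRr1// ltW.
by apply: ge0_ler_powR; rewrite ?nnegrE// ltW.
Qed.

(** The factor |a1 - a2|^(tau / 2) < 1 puts delta strictly below the supremum, so some admissible e
    exceeds it and [H_eps] is larger still at delta. As the supremum is at most the same power,
    delta is at most |a1 - a2|^tau. *)
Lemma delta_props (tau a1 a2 : R) : (0 < tau)%R -> (l <= a1 <= u)%R -> (l <= a2 <= u)%R ->
    (0 < `|a1 - a2| < 1)%R ->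
  [/\ (0 < delta tau a1 a2)%R, (delta tau a1 a2 <= `|a1 - a2| `^ tau)%R &
    forall a, a \in [:: a1; a2] ->
      H a - (`|a1 - a2| `^ tau)%:E < H_eps a (delta tau a1 a2)].
Proof.
move=> tau0 a1I a2I /andP[d0 d1]; rewrite /Defs.delta.
set t : R := `|a1 - a2|%R; set D := [set e : R | _].
have I' a : (l <= a <= u)%R -> (0 < a <= 1)%R by case/andP; exact: I.
have tt0 : (0 < t `^ tau)%R by exact: powR_gt0.
have h0 : (0 < t `^ (tau / 2))%R by exact: powR_gt0.
have h1 : (t `^ (tau / 2) < 1)%R.
  have p1 : (1 `^ (tau / 2) = 1 :> R)%R by rewrite powR1.
  rewrite -[ltRHS]p1.
  by apply: gt0_ltr_powR; rewrite ?nnegrE ?divr_gt0// ltW.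
have hh : (t `^ (tau / 2) * t `^ (tau / 2) = t `^ tau)%R.
  rewrite -powRD; first by congr (_ `^ _)%R; field.
  by apply/implyP => _; rewrite gt_eqF.
have [e1 /andP[e10 e11] He1] := H_adherent (I' _ a1I) tt0.
have [e2 /andP[e20 e21] He2] := H_adherent (I' _ a2I) tt0.
pose e := (Num.min (Num.min e1 e2) (t `^ (tau / 2) / 2))%R.
have De : D e.
  split.
    rewrite !lt_min e10 e20 divr_gt0//= gt_min; apply/orP; right; lra.
  move=> a; rewrite !inE => /orP[/eqP->|/eqP->].
    by apply: lt_le_trans He1 _; apply: H_eps_anti; rewrite !ge_min lexx.
  by apply: lt_le_trans He2 _; apply: H_eps_anti; rewrite !ge_min lexx orbT.
have e0 : (0 < e)%R by case: De => /andP[].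
have ubD : ubound D (t `^ (tau / 2))%R by move=> x [/andP[_ /ltW]].
have hsD : has_sup D by split; [exists e|exists (t `^ (tau / 2))%R].
have sD0 : (0 < sup D)%R by apply: lt_le_trans e0 _; apply: ub_le_sup => //; case: hsD.
have sDh : (sup D <= t `^ (tau / 2))%R by apply: ge_sup => //; case: hsD.
split.
- by rewrite mulr_gt0.
- by rewrite -hh; apply: ler_wpM2l => //; exact: ltW.
- move=> a aI.
  have lt : (t `^ (tau / 2) * sup D < sup D)%R by rewrite gtr_pMl.
  have pos : (0 < sup D - t `^ (tau / 2) * sup D)%R by rewrite subr_gt0.
  have [x [_ Dx] xlt] := sup_adherent pos hsD.
  apply: lt_le_trans (Dx a aI) _; apply: H_eps_anti; lra.
Qed.

Let powR_le1 (t tau : R) : (0 < tau)%R -> (0 < t < 1)%R -> (t `^ tau <= 1)%R.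
Proof.
move=> tau0 /andP[t0 t1]; have p1 : (1 `^ tau = 1 :> R)%R by rewrite powR1.
rewrite -[leRHS]p1.
by apply: ge0_ler_powR; rewrite ?nnegrE// ltW.
Qed.

Let powR_pred (t tau : R) : (0 < t)%R -> (t `^ tau = t * t `^ (tau - 1))%R.
Proof.
move=> t0; rewrite -{2}[t]powRr1 ?ltW// -powRD; first by congr (_ `^ _)%R; ring.
by apply/implyP => _; rewrite gt_eqF.
Qed.

(** The hypothesis of [ge_left_slope] and [near_opt_shift], with k = |a1 - a2|^tau. *)
Lemma delta_bounded (tau a1 a2 a : R) A : (0 < tau)%R ->
    (l <= a1 <= u)%R -> (l <= a2 <= u)%R -> (0 < `|a1 - a2| < 1)%R ->
    a \in [:: a1; a2] -> bounded_covers (delta tau a1 a2) A ->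
  (fine (H a) - `|a1 - a2| `^ tau <= powv a A)%R.
Proof.
move=> tau0 a1I a2I dI aa [C0A LA].
have [d0 dt Hd] := delta_props tau0 a1I a2I dI.
have d1 := le_trans dt (powR_le1 tau0 dI).
have aI : (l <= a <= u)%R by move: aa; rewrite !inE => /orP[/eqP->|/eqP->].
have D1A : bounded_covers 1%R A by split => //; exact: C0_sub C0A.
rewrite -lee_fin EFinB -(powvE D1A aI) fineK; last first.
  by apply: H_fin; case/andP: aI; exact: I.
apply: le_trans (ltW (Hd a aa)) _.
by apply: ereal_inf_lbound; exists A.
Qed.

(** * One-sided limits at an interior exponent *)

Section at_point.
Variable a : R.
Hypotheses (la : (l < a)%R) (au : (a < u)%R).

Local Notation left_slope :=
  (left_slope bounded_covers powv powlogv (fun x => fine (H x)) a).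
Local Notation right_slope :=
  (right_slope bounded_covers powv powlogv (fun x => fine (H x)) a).

Let aI : (l <= a <= u)%R. Proof. by rewrite !ltW. Qed.

(** The upper bound only needs b and c close to a and e small. The lower bound needs e + k small
    compared with a - b, which is where tau > 1 enters. *)
Lemma left_slope_near (tau eta : R) : (1 < tau)%R -> (0 < eta)%R ->
  exists2 r : R, (0 < r <= 1)%R & forall b c : R, (a - r < b < a)%R ->
    (`|c - a| < r)%R ->
    [/\ (l <= b <= u)%R, (l <= c <= u)%R, (0 < delta tau b a <= 1)%R,
      (delta tau b a <= eta)%R &
      forall (e : R) A, (0 < e <= delta tau b a)%R -> near_opt b e A ->
        (left_slope - eta <= powlogv c A <= left_slope + eta)%R].
Proof.
move=> tau1 eta0.
have [r0 /andP[r00 r01] Hr0] := interval_near la au.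
have [r1 /andP[r10 r11] Hr1] := le_left_slope cf la au eta0.
have [r2 /andP[r20 r21] Hr2] := ge_left_slope cf la au eta0.
have tau10 : (0 < tau - 1)%R by rewrite subr_gt0.
have [r3 /andP[r30 r31] Hr3] := powR_small tau10 (divr_gt0 r20 (ltr0Sn _ 1)).
pose r := Num.min (Num.min r0 r1) (Num.min r2 (Num.min r3 eta)).
have rp : (0 < r)%R by rewrite !lt_min r00 r10 r20 r30.
have rr0 : (r <= r0)%R by rewrite !ge_min lexx.
have rr1 : (r <= r1)%R by rewrite !ge_min lexx !orbT.
have rr2 : (r <= r2)%R by rewrite !ge_min lexx !orbT.
have rr3 : (r <= r3)%R by rewrite !ge_min lexx !orbT.
have rreta : (r <= eta)%R by rewrite !ge_min lexx !orbT.
exists r; first by rewrite rp (le_trans rr0).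
move=> b c /andP[rb ba] ca.
have nba : `|b - a|%R = (a - b)%R by rewrite distrC gtr0_norm ?subr_gt0.
have bI : (l <= b <= u)%R by apply: Hr0; rewrite nba; lra.
have cI : (l <= c <= u)%R by apply: Hr0; exact: lt_le_trans rr0.
have tau0 : (0 < tau)%R by lra.
have tI : (0 < `|b - a| < 1)%R by rewrite nba; apply/andP; split; lra.
have [d0 dt _] := delta_props tau0 bI aI tI.
have dB A' a' := @delta_bounded tau _ _ a' A' tau0 bI aI tI.
move: dB d0 dt; move: (delta tau b a) => dl dB d0 dt.
have t0 : (0 < `|b - a|)%R by case/andP: tI.
(* Both e and k are at most |b - a|^tau, so each takes half of the allowance r2 |b - a|. *)
have tt : (`|b - a| `^ tau <= `|b - a| * (r2 / 2))%R.
  rewrite powR_pred//; apply: ler_wpM2l; first exact: ltW.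
  by apply: Hr3; rewrite ltW//= nba; lra.
have tr2 : (`|b - a| * (r2 / 2) <= `|b - a|)%R by rewrite ler_piMr ?ltW//; lra.
have d1 : (dl <= `|b - a|)%R by lra.
split => //; [by rewrite d0/= nba in d1 *; lra|by rewrite nba in d1; lra|].
move=> e A /andP[e0 ed] nA.
have e1 : (e <= 1)%R by rewrite nba in d1; lra.
apply/andP; split.
  apply: (Hr2 b c e (`|b - a| `^ tau)%R A) => //.
  - by apply/andP; split; lra.
  - exact: lt_le_trans rr2.
  - by rewrite e0.
  - by rewrite nba in tt dt *; lra.
  - move=> A' DA'; apply: dB; first by rewrite !inE eqxx orbT.
    apply: (cf_D cf e0 ed _ DA'); rewrite nba in d1; lra.
apply: (Hr1 b c e A) => //.
- by rewrite nba; lra.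
- exact: lt_le_trans rr1.
- by rewrite e0/=; rewrite nba in d1; lra.
Qed.

(** On this side it is the upper bound that depends on tau > 1. *)
Lemma right_slope_near (tau eta : R) : (1 < tau)%R -> (0 < eta)%R ->
  exists2 r : R, (0 < r <= 1)%R & forall b c : R, (a < b < a + r)%R ->
    (`|c - a| < r)%R ->
    [/\ (l <= b <= u)%R, (l <= c <= u)%R, (0 < delta tau a b <= 1)%R,
      (delta tau a b <= eta)%R &
      forall (e : R) A, (0 < e <= delta tau a b)%R -> near_opt b e A ->
        (right_slope - eta <= powlogv c A <= right_slope + eta)%R].
Proof.
move=> tau1 eta0.
have [r0 /andP[r00 r01] Hr0] := interval_near la au.
have [r1 /andP[r10 r11] Hr1] := ge_right_slope cf la au eta0.
have [r2 /andP[r20 r21] Hr2] := le_right_slope cf la au eta0.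
have tau10 : (0 < tau - 1)%R by rewrite subr_gt0.
have [r3 /andP[r30 r31] Hr3] := powR_small tau10 (divr_gt0 r20 (ltr0Sn _ 1)).
pose r := Num.min (Num.min r0 r1) (Num.min r2 (Num.min r3 eta)).
have rp : (0 < r)%R by rewrite !lt_min r00 r10 r20 r30.
have rr0 : (r <= r0)%R by rewrite !ge_min lexx.
have rr1 : (r <= r1)%R by rewrite !ge_min lexx !orbT.
have rr2 : (r <= r2)%R by rewrite !ge_min lexx !orbT.
have rr3 : (r <= r3)%R by rewrite !ge_min lexx !orbT.
have rreta : (r <= eta)%R by rewrite !ge_min lexx !orbT.
exists r; first by rewrite rp (le_trans rr0).
move=> b c /andP[ab br] ca.
have nba : `|b - a|%R = (b - a)%R by rewrite gtr0_norm ?subr_gt0.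
have nab : `|a - b|%R = (b - a)%R by rewrite distrC.
have bI : (l <= b <= u)%R by apply: Hr0; rewrite nba; lra.
have cI : (l <= c <= u)%R by apply: Hr0; exact: lt_le_trans rr0.
have tau0 : (0 < tau)%R by lra.
have tI : (0 < `|a - b| < 1)%R by rewrite nab; apply/andP; split; lra.
have [d0 dt _] := delta_props tau0 aI bI tI.
have dB A' a' := @delta_bounded tau _ _ a' A' tau0 aI bI tI.
move: dB d0 dt; move: (delta tau a b) => dl dB d0 dt.
have t0 : (0 < `|a - b|)%R by case/andP: tI.
have tt : (`|a - b| `^ tau <= `|a - b| * (r2 / 2))%R.
  rewrite powR_pred//; apply: ler_wpM2l; first exact: ltW.
  by apply: Hr3; rewrite ltW//= nab; lra.
have tr2 : (`|a - b| * (r2 / 2) <= `|a - b|)%R by rewrite ler_piMr ?ltW//; lra.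
have d1 : (dl <= `|a - b|)%R by lra.
split => //; [by rewrite d0/= nab in d1 *; lra|by rewrite nab in d1; lra|].
move=> e A /andP[e0 ed] nA.
have e1 : (e <= 1)%R by rewrite nab in d1; lra.
apply/andP; split; last first.
  apply: (Hr2 b c e (`|a - b| `^ tau)%R A) => //.
  - by apply/andP; split; lra.
  - exact: lt_le_trans rr2.
  - by rewrite e0.
  - by rewrite nab in tt dt *; lra.
  - move=> A' DA'; apply: dB; first by rewrite !inE eqxx.
    apply: (cf_D cf e0 ed _ DA'); rewrite nab in d1; lra.
apply: (Hr1 b c e A) => //.
- by rewrite nba; lra.
- exact: lt_le_trans rr1.
- by rewrite e0/=; rewrite nab in d1; lra.
Qed.

Local Notation Kc := slope_const.

Let Kc0 : (0 <= Kc)%R. Proof. exact: cf_K cf. Qed.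

(** The uniform bound on slopes makes [Xi_eps] a real number, so that [fine] in [eps'] loses
    nothing. *)
Lemma Xi_eps_fin : exists2 K : R, (0 <= K)%R &
  forall b c e : R, (l <= b <= u)%R -> (l <= c <= u)%R -> (0 < e <= 1)%R ->
  exists x : R, [/\ Xi_eps c b e = x%:E, (`|x| <= K)%R,
    forall A, Cb01 b e A -> (powlogv c A <= x)%R &
    forall v : R, (forall A, Cb01 b e A -> (powlogv c A <= v)%R) -> (x <= v)%R].
Proof.
exists Kc; first exact: Kc0.
move=> b c e bI cI eI; have [|/andP[lo hi] _ _ _] := @slopes_within b c e (- Kc)%R Kc bI cI eI.
  move=> e' A /andP[e'0 e'e] nA; have e'I : (0 < e' <= 1)%R.
    by rewrite e'0 (le_trans e'e)//; case/andP: eI.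
  by have := cf_bound cf (cf_D1 cf e'I nA.1) cI; rewrite ler_norml.
have Xf : Xi_eps c b e \is a fin_num.
  rewrite fin_numE -ltNye -ltey.
  by rewrite (lt_le_trans _ lo) ?ltNyr// (le_lt_trans hi) ?ltry.
exists (fine (Xi_eps c b e)); rewrite fineK//; split => //.
- by rewrite ler_norml -!lee_fin fineK// lo.
- by move=> A cA; rewrite -lee_fin (fineK Xf); exact: Xi_eps_ge.
- by move=> v vA; rewrite -lee_fin (fineK Xf); exact: Xi_eps_le.
Qed.

Lemma eps'_props (tau eta : R) : (0 < tau)%R -> (0 < eta)%R ->
  exists2 r : R, (0 < r <= 1)%R & forall b : R, (a < b < a + r)%R ->
    [/\ (l <= b <= u)%R, (0 < delta tau a b)%R,
        (delta tau a b <= eps' tau a b)%R, (eps' tau a b <= eta)%R &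
        Cb01 a (delta tau a b) `<=` Cb01 b (eps' tau a b)].
Proof.
move=> tau0; have [K Kge0 Xfin] := Xi_eps_fin; wlog : eta / (eta <= 1)%R.
  move=> W eta0.
  have m0 : (0 < Num.min eta 1)%R by rewrite lt_min eta0 ltr01.
  have m1 : (Num.min eta 1 <= 1)%R by rewrite ge_min lexx orbT.
  have [r rI Hr] := W (Num.min eta 1)%R m1 m0.
  exists r => // b /Hr[bI d0 de ee sub]; split => //.
  by apply: le_trans ee _; rewrite ge_min lexx.
move=> eta1 eta0.
have [r0 /andP[r00 r01] Hr0] := interval_near la au.
(* As delta <= (b - a)^tau, the last two terms of [eps'] are at most 5 (b - a)^tau; with eta / 10
   they fit into eta / 2, and the first term takes the other half. *)
have [r3 /andP[r30 r31] Hr3] := powR_small tau0 (divr_gt0 eta0 (ltr0Sn _ 9)).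
have K1 : (0 < 2 * K + 1)%R by lra.
exists (Num.min r0 (Num.min r3 (eta / 2 / (2 * K + 1))))%R.
  by rewrite !lt_min r00 r30 !divr_gt0// ge_min r01.
move=> b /andP[ab]; rewrite -ltrBlDl !lt_min ltr_pdivlMr// => /and3P[br0 br3 brK].
have t0 : (0 < b - a)%R by rewrite subr_gt0.
have nba : `|b - a|%R = (b - a)%R by rewrite gtr0_norm.
have nab : `|a - b|%R = (b - a)%R by rewrite distrC.
have bI : (l <= b <= u)%R by apply: Hr0; rewrite nba.
have tI : (0 < `|a - b| < 1)%R by rewrite nab t0 (lt_le_trans br0).
have [d0 dt _] := delta_props tau0 aI bI tI.
have kle : ((b - a) `^ tau <= eta / 10)%R by apply: Hr3; rewrite ltW.
have dB A' a' := @delta_bounded tau _ _ a' A' tau0 aI bI tI.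
rewrite /Defs.eps'.
move: dB d0 dt; move: (delta tau a b) => dl; rewrite nab => dB d0 dk.
have dI : (0 < dl <= 1)%R by rewrite d0/= (le_trans dk)// (le_trans kle)//; lra.
have [X1 [X1E X1K X1ub X1lub]] := Xfin _ _ _ aI bI dI.
have [X2 [X2E X2K X2ub X2lub]] := Xfin _ _ _ bI aI dI.
rewrite X1E X2E /=.
have aI' : (0 < a <= 1)%R by case/andP: aI; exact: I.
have yu : (b <= u)%R by case/andP: bI.
have nA A := @Cb01_near_opt a dl A aI dI.
have [eps_ge eps_sub] := near_opt_shift cf (ltW la) ab yu dI
  (fun A => dB A a (mem_head a [:: b])) (fun A => dB A b (mem_last a [:: b]))
  (Cb01_ex aI' d0) nA (fun A => @Cb01_near_opt b dl A bI dI) X1ub X2lub.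
have eps_le : ((b - a) * (X1 - X2) + 2 * (b - a) `^ tau + 3 * dl <= eta)%R.
  have : ((b - a) * (X1 - X2) <= (b - a) * (2 * K))%R.
    apply: ler_wpM2l; first exact: ltW.
    by move: X1K X2K; rewrite !ler_norml => /andP[_ ?] /andP[? _]; lra.
  lra.
split; [exact: bI|exact: d0|exact: eps_ge|exact: eps_le|move=> A cA].
apply: (Cb01_near_opt_trans bI aI d0 eps_ge _ cA); first exact: le_trans eps_le eta1.
split; last exact: eps_sub cA.
by apply: (cf_D cf d0 eps_ge _ (nA A cA).1); exact: le_trans eps_le eta1.
Qed.

Lemma left_quotient_cvg : left_quotient H a b @[b --> a^'-] --> left_slope%:E.
Proof.
apply: cvg_at_left_between => eta eta0.
have [r0 /andP[r00 r01] Hr0] := interval_near la au.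
have [r1 /andP[r10 r11] Hr1] := quotient_le_left_slope cf la au eta0.
have [r2 /andP[r20 r21] Hr2] := left_slope_le_quotient cf la au eta0.
exists (Num.min r0 (Num.min r1 r2)); first by rewrite !lt_min r00 r10.
move=> b /andP[+ ba]; rewrite ltrBlDr addrC -ltrBlDr !lt_min => /and3P[b0 b1 b2].
have t0 : (0 < a - b)%R by rewrite subr_gt0.
have bI : (l <= b <= u)%R by apply: Hr0; rewrite distrC gtr0_norm.
have fin c : (l <= c <= u)%R -> H c \is a fin_num.
  by move=> /andP[lc cu]; apply: H_fin; exact: I.
have b1' : (a - r1 < b < a)%R by rewrite ba andbT; lra.
have b2' : (a - r2 < b < a)%R by rewrite ba andbT; lra.
have hi := Hr1 b b1'; have lo := Hr2 b b2'.
rewrite /left_quotient -(fineK (fin _ bI)) -(fineK (fin _ aI)) -EFinB -EFinM !lee_fin.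
exact: quotient_between ba lo hi.
Qed.

Lemma left_derivativeE : left_derivative H a = left_slope%:E.
Proof. by apply/cvg_lim => //; exact: left_quotient_cvg. Qed.

(** [left_slope] is a supremum over [near_opt], which is larger than [Cb01]. For the lower bound, a
    cover of [Cb01] at an exponent a - s slightly to the left has slope near [left_slope] and still
    belongs to [Cb01] at a. The value 2 is just some tau > 1. *)
Lemma Xi_diagonal : Xi a a = left_slope%:E.
Proof.
apply/eqP; rewrite eq_le; apply/andP; split.
  apply/lee_addgt0Pr => eta eta0; rewrite -EFinD.
  have [r rI Hr] := le_left_slope cf la au eta0; have [r0 r1] := andP rI.
  apply: le_trans (Xi_le_eps _ aI r0) _; apply: Xi_eps_le => // A cA.
  by apply: (Hr a a r); rewrite ?subrr ?normr0 ?r0 ?lexx//; exact: Cb01_near_opt.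
apply: Xi_ge => // e /andP[e0 e1]; apply/lee_addgt0Pr => eta eta0.
have [r /andP[r0 r1] Hr] := left_slope_near (ltr1n R 2) eta0.
have [s /andP[s0 sr] Ks] := small_shift Kc0 (divr_gt0 e0 (ltr0Sn _ 1)) r0.
have bB : (a - r < a - s < a)%R by apply/andP; split; lra.
have aa : (`|a - a| < r)%R by rewrite subrr normr0.
have [bI _ /andP[d0 d1] _ Hd] := Hr (a - s)%R a bB aa.
pose e' := (Num.min (delta 2 (a - s) a) (e / 2))%R.
have e'0 : (0 < e')%R by rewrite lt_min d0 divr_gt0.
have e'd : (e' <= delta 2 (a - s) a)%R by rewrite ge_min lexx.
have e'e : (e' <= e / 2)%R by rewrite ge_min lexx orbT.
have bI' : (0 < a - s <= 1)%R by case/andP: bI; exact: I.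
have [A cA] := Cb01_ex bI' e'0.
have e'I : (0 < e' <= 1)%R by rewrite e'0 (le_trans e'd).
have nA := Cb01_near_opt bI e'I cA.
have nsa : (`|a - s - a| = s)%R by rewrite addrAC subrr add0r normrN gtr0_norm.
have nA' : near_opt a e A.
  apply: (near_opt_sub cf aI bI e'0 (ltW e1) _ nA); rewrite nsa.
  by rewrite [leRHS]splitr lerD.
have ee' : (e' <= e)%R by lra.
have cA' := Cb01_near_opt_trans aI bI e'0 ee' (ltW e1) cA nA'.
have eI : (0 < e <= 1)%R by rewrite e0 ltW.
apply: (@le_trans _ _ ((powlogv a A)%:E + eta%:E)); last first.
  by rewrite leeD2r// Xi_eps_ge.
rewrite -EFinD lee_fin -lerBlDr.
by have /andP[] := Hd e' A (introT andP (conj e'0 e'd)) nA.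
Qed.

(** The covers that nearly attain the infimum are optimal for an exponent a + s slightly to the
    right. *)
Lemma Psi_diagonal : Psi a a = right_slope%:E.
Proof.
apply/eqP; rewrite eq_le; apply/andP; split; last first.
  apply/lee_addgt0Pr => eta eta0.
  have eta20 : (0 < eta / 2)%R by rewrite divr_gt0.
  have [r /andP[r0 r1] Hr] := ge_right_slope cf la au eta20.
  (* The second bound absorbs the loss l^-1 e of [Psi_eps_ge]. *)
  pose e := Num.min r (l * (eta / 2))%R.
  have e0 : (0 < e)%R by rewrite lt_min r0 mulr_gt0.
  have er : (e <= r)%R by rewrite ge_min lexx.
  have el : (l^-1 * e <= eta / 2)%R.
    by rewrite mulrC ler_pdivrMr// mulrC ge_min lexx orbT.
  have eI : (0 < e <= 1)%R by rewrite e0 (le_trans er).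
  apply: (@le_trans _ _ (Psi_eps a a e + eta%:E)); last first.
    by rewrite leeD2r// Psi_ge_eps.
  rewrite -leeBlDr// -EFinB.
  apply: (@le_trans _ _ (right_slope - eta / 2 - l^-1 * e)%:E).
    by rewrite lee_fin; lra.
  apply: Psi_eps_ge => // A nA.
  by apply: (Hr a a e); rewrite ?subrr ?normr0 ?e0.
apply: Psi_le => e /andP[e0 e1]; apply/lee_addgt0Pr => eta eta0; rewrite -EFinD.
have [r /andP[r0 r1] Hr] := right_slope_near (ltr1n R 2) eta0.
have [s /andP[s0 sr] Ks] := small_shift Kc0 (divr_gt0 e0 (ltr0Sn _ 1)) r0.
have bB : (a < a + s < a + r)%R by apply/andP; split; lra.
have aa : (`|a - a| < r)%R by rewrite subrr normr0.
have [bI _ /andP[d0 d1] _ Hd] := Hr (a + s)%R a bB aa.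
pose e' := (Num.min (delta 2 a (a + s)) (e / 2))%R.
have e'0 : (0 < e')%R by rewrite lt_min d0 divr_gt0.
have e'd : (e' <= delta 2 a (a + s))%R by rewrite ge_min lexx.
have e'e : (e' <= e / 2)%R by rewrite ge_min lexx orbT.
have e'I : (0 < e' <= 1)%R by rewrite e'0 (le_trans e'd).
have [A nA] := near_opt_ex cf bI e'I.
have nsa : (`|a + s - a| = s)%R by rewrite addrAC subrr add0r gtr0_norm.
have nA' : near_opt a e A.
  apply: (near_opt_sub cf aI bI e'0 (ltW e1) _ nA); rewrite nsa.
  by rewrite [leRHS]splitr lerD.
have eI : (0 < e <= 1)%R by rewrite e0 ltW.
apply: le_trans (Psi_eps_le aI aI eI nA') _; rewrite lee_fin.
by have /andP[] := Hd e' A (introT andP (conj e'0 e'd)) nA.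
Qed.

Section left_and_right_limits.
(** The exponent c b of the integrand is either a or b; both cases are treated at once. *)
Variable c : R -> R.
Hypothesis c_near : forall b, (`|c b - a| <= `|b - a|)%R.

Let left_within (tau eta : R) : (1 < tau)%R -> (0 < eta)%R ->
  exists2 r : R, (0 < r)%R & forall b, (a - r < b < a)%R ->
  [/\ (left_slope - eta)%:E <= Xi (c b) b <= (left_slope + eta)%:E,
      (left_slope - eta)%:E <= Psi_eps (c b) b (delta tau b a) <=
        (left_slope + eta)%:E &
      (left_slope - eta)%:E <= Psi (c b) b <= (left_slope + eta)%:E].
Proof.
move=> tau1 eta0; pose eta' := (Num.min (eta / 2) (l * (eta / 2)))%R.
have eta20 : (0 < eta / 2)%R by rewrite divr_gt0.
have eta'0 : (0 < eta')%R by rewrite lt_min eta20 mulr_gt0.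
have eta'2 : (eta' <= eta / 2)%R by rewrite ge_min lexx.
have eta'l : (l^-1 * eta' <= eta / 2)%R.
  by rewrite mulrC ler_pdivrMr// mulrC ge_min lexx orbT.
have [r /andP[r0 _] Hr] := left_slope_near tau1 eta'0; exists r => // b bB.
have cB : (`|c b - a| < r)%R.
  apply: le_lt_trans (c_near b) _; case/andP: bB => ? ba.
  by rewrite distrC gtr0_norm ?subr_gt0//; lra.
have [bI cI dI dle Hd] := Hr b (c b) bB cB.
have [_ bX P1 P2] := slopes_within bI cI dI Hd.
have ld : (l^-1 * delta tau b a <= eta / 2)%R.
  by apply: le_trans eta'l; apply: ler_wpM2l.
have lo1 : ((left_slope - eta)%:E <= (left_slope - eta' - l^-1 * delta tau b a)%:E).
  by rewrite lee_fin [eta in leLHS]splitr opprD addrA; apply: lerB => //; apply: lerB.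
have lo2 : ((left_slope - eta)%:E <= (left_slope - eta')%:E).
  by rewrite lee_fin; apply: lerB => //; apply: le_trans eta'2 _; lra.
have hi1 : ((left_slope + eta')%:E <= (left_slope + eta)%:E).
  by rewrite lee_fin; apply: lerD => //; apply: le_trans eta'2 _; lra.
split; apply/andP.
- by case/andP: bX => /(le_trans lo2) ? /le_trans /(_ hi1).
- by case/andP: P1 => /(le_trans lo1) ? /le_trans /(_ hi1).
- by case/andP: P2 => /(le_trans lo1) ? /le_trans /(_ hi1).
Qed.

Lemma Xi_cvg_left : Xi (c b) b @[b --> a^'-] --> left_slope%:E.
Proof.
apply: cvg_at_left_between => eta eta0.
have [r r0 Hr] := left_within (ltr1n R 2) eta0.
by exists r => // b /Hr[].
Qed.

Lemma Psi_eps_cvg_left (tau : R) : (1 < tau)%R ->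
  Psi_eps (c b) b (delta tau b a) @[b --> a^'-] --> left_slope%:E.
Proof.
move=> tau1; apply: cvg_at_left_between => eta eta0.
have [r r0 Hr] := left_within tau1 eta0.
by exists r => // b /Hr[].
Qed.

Lemma Psi_cvg_left : Psi (c b) b @[b --> a^'-] --> left_slope%:E.
Proof.
apply: cvg_at_left_between => eta eta0.
have [r r0 Hr] := left_within (ltr1n R 2) eta0.
by exists r => // b /Hr[].
Qed.

Let right_within (tau eta : R) : (1 < tau)%R -> (0 < eta)%R ->
  exists2 r : R, (0 < r)%R & forall b, (a < b < a + r)%R ->
  (right_slope - eta)%:E <= Xi_eps (c b) b (delta tau a b) <= (right_slope + eta)%:E /\
  (right_slope - eta)%:E <= Xi (c b) b <= (right_slope + eta)%:E.
Proof.
move=> tau1 eta0.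
have [r /andP[r0 _] Hr] := right_slope_near tau1 eta0; exists r => // b bB.
have cB : (`|c b - a| < r)%R.
  apply: le_lt_trans (c_near b) _; case/andP: bB => ab ?.
  by rewrite gtr0_norm ?subr_gt0//; lra.
have [bI cI dI dle Hd] := Hr b (c b) bB cB.
by have [X1 X2 _ _] := slopes_within bI cI dI Hd.
Qed.

Lemma Xi_eps_cvg_right (tau : R) : (1 < tau)%R ->
  Xi_eps (c b) b (delta tau a b) @[b --> a^'+] --> right_slope%:E.
Proof.
move=> tau1; apply: cvg_at_right_between => eta eta0.
have [r r0 Hr] := right_within tau1 eta0.
by exists r => // b /Hr[].
Qed.

Lemma Xi_cvg_right : Xi (c b) b @[b --> a^'+] --> right_slope%:E.
Proof.
apply: cvg_at_right_between => eta eta0.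
have [r r0 Hr] := right_within (ltr1n R 2) eta0.
by exists r => // b /Hr[].
Qed.

(** The limit from the right is the left slope. The upper bound is [le_left_slope], as [eps'] tends
    to 0. For the lower bound, the competitors for a at level delta are also competitors for b at
    level [eps'], and their slopes grow with the exponent because a <= c b. *)
Lemma Xi_eps'_cvg_right (tau : R) : (0 < tau)%R -> (forall b, (a < b)%R -> (a <= c b)%R) ->
  Xi_eps (c b) b (eps' tau a b) @[b --> a^'+] --> left_slope%:E.
Proof.
move=> tau0 ac; apply: cvg_at_right_between => eta eta0.
have [r1 /andP[r10 r11] Hr1] := le_left_slope cf la au eta0.
have [r0 /andP[r00 r01] Hr0] := interval_near la au.
have [r2 /andP[r20 r21] Hr2] := eps'_props tau0 r10.
exists (Num.min r0 (Num.min r1 r2)); first by rewrite !lt_min r00 r10.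
move=> b /andP[ab]; rewrite -ltrBlDl !lt_min => /and3P[br0 br1 br2].
have nba : `|b - a|%R = (b - a)%R by rewrite gtr0_norm ?subr_gt0.
have b2 : (a < b < a + r2)%R by rewrite ab -ltrBlDl.
have [bI d0 de er1 sub] := Hr2 b b2.
have cba := c_near b; rewrite nba in cba.
have cI : (l <= c b <= u)%R by apply: Hr0; exact: le_lt_trans br0.
have eI : (0 < eps' tau a b <= 1)%R.
  by rewrite (lt_le_trans d0)//= (le_trans er1).
have dI : (0 < delta tau a b <= 1)%R.
  by rewrite d0/= (le_trans de)//; case/andP: eI.
apply/andP; split.
  rewrite EFinB leeBlDr//; apply: (@le_trans _ _ (Xi_eps (c b) b (eps' tau a b))); last first.
    by rewrite leeDl// lee_fin ltW.
  rewrite -Xi_diagonal; apply: le_trans (Xi_le_eps _ aI d0) _.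
  have [K _ Xfin] := Xi_eps_fin; have [x [-> _ xub _]] := Xfin _ _ _ bI cI eI.
  apply: Xi_eps_le => // A cA; apply: le_trans (xub A (sub A cA)).
  have nA := Cb01_near_opt aI dI cA.
  by apply: (cf_mono cf (cf_D1 cf dI nA.1) (ltW la) (ac _ ab)); case/andP: cI.
apply: Xi_eps_le => // A /(Cb01_near_opt bI eI) nA.
apply: (Hr1 b (c b) (eps' tau a b) A) => //.
- by rewrite nba.
- exact: le_lt_trans br1.
- by rewrite er1 andbT; case/andP: eI.
Qed.

End left_and_right_limits.

End at_point.

End interval.

End near_optimal.

(** * Assembly of the one-sided limits *)

Theorem theorem6 (d : measure_display) (X : measurableType d) (R : realType)
    (S : X -> X) (bijS : bijective S)
    (phi0 Lambda : {finite_measure set (A0 S) -> \bar R})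
    (Lambda_inv : forall A : set (A0 S), measurable A ->
       Lambda (S @^-1` A) = Lambda A)
    (Lambda_ac : Lambda `<< phi0)
    (Z : A0 S -> \bar R)
    (Z_ge0 : forall x, 0 <= Z x)
    (Z_meas : measurable_fun [set: A0 S] Z)
    (Z_density : forall A : set (A0 S), measurable A ->
       Lambda A = \int[phi0]_(x in A) Z x)
    (Q : set X) (BQ : sigma_B S Q) :
  let Hb := H phi0 Z Q in
  let Psi_e := Psi_eps phi0 Z Q in
  let Psi1 := Psi phi0 Z Q in
  let Xi_e := Xi_eps phi0 Lambda Z Q in
  let Xi1 := Xi phi0 Lambda Z Q in
  let delt := delta phi0 Z Q in
  let epsil' := eps' phi0 Lambda Z Q in
  [/\ (forall a : R, (0 < a < 1)%R -> left_derivable Hb a),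
      (forall a tau : R, (0 < a < 1)%R -> (1 < tau)%R ->
         left_derivative Hb a = Xi1 a a /\
         [/\ Xi1 a b @[b --> a^'-] --> left_derivative Hb a,
             Xi1 b b @[b --> a^'-] --> left_derivative Hb a,
             Psi_e a b (delt tau b a) @[b --> a^'-] --> left_derivative Hb a &
             Psi_e b b (delt tau b a) @[b --> a^'-] --> left_derivative Hb a] /\
         Psi1 a b @[b --> a^'-] --> left_derivative Hb a /\
         Psi1 b b @[b --> a^'-] --> left_derivative Hb a),
      (forall a0 tau : R, (0 < a0 < 1)%R -> (0 < tau)%R ->
         Xi_e a a (epsil' tau a0 a) @[a --> a0^'+] --> Xi1 a0 a0 /\
         Xi_e a0 a (epsil' tau a0 a) @[a --> a0^'+] --> Xi1 a0 a0) &
      (forall a0 tau : R, (0 < a0 < 1)%R -> (1 < tau)%R ->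
         [/\ Xi_e a a (delt tau a0 a) @[a --> a0^'+] --> Psi1 a0 a0,
             Xi_e a0 a (delt tau a0 a) @[a --> a0^'+] --> Psi1 a0 a0,
             Xi1 a a @[a --> a0^'+] --> Psi1 a0 a0 &
             Xi1 a0 a @[a --> a0^'+] --> Psi1 a0 a0])].
Proof.
move=> Hb Psi_e Psi1 Xi_e Xi1 delt epsil'.
(* The interval [a / 2, (a + 1) / 2] is a compact part of ]0, 1[ around a. It may depend on a, since
   every limit is taken at a fixed exponent. *)
have l0 (a : R) : (0 < a < 1)%R -> (0 < a / 2)%R by move=> /andP[? ?]; lra.
have u1 (a : R) : (0 < a < 1)%R -> ((a + 1) / 2 < 1)%R by move=> /andP[? ?]; lra.
have la (a : R) : (0 < a < 1)%R -> (a / 2 < a)%R by move=> /andP[? ?]; lra.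
have au (a : R) : (0 < a < 1)%R -> (a < (a + 1) / 2)%R by move=> /andP[? ?]; lra.
have c_a (a b : R) : (`|a - a| <= `|b - a|)%R by rewrite subrr normr0.
have c_id (a b : R) : (`|id b - a| <= `|b - a|)%R by [].
have quotient (a : R) aI := left_quotient_cvg bijS Lambda_inv Z_ge0 Z_meas Z_density BQ
  (l0 a aI) (u1 a aI) (la a aI) (au a aI).
have derivative (a : R) aI := left_derivativeE bijS Lambda_inv Z_ge0 Z_meas Z_density BQ
  (l0 a aI) (u1 a aI) (la a aI) (au a aI).
have XiE (a : R) aI := Xi_diagonal bijS Lambda_inv Z_ge0 Z_meas Z_density BQ
  (l0 a aI) (u1 a aI) (la a aI) (au a aI).
have PsiE (a : R) aI := Psi_diagonal bijS Lambda_inv Z_ge0 Z_meas Z_density BQ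
  (l0 a aI) (u1 a aI) (la a aI) (au a aI).
have Xi_left (a : R) aI := Xi_cvg_left bijS Lambda_inv Z_ge0 Z_meas Z_density BQ
  (l0 a aI) (u1 a aI) (la a aI) (au a aI).
have Psi_e_left (a : R) aI := Psi_eps_cvg_left bijS Lambda_inv Z_ge0 Z_meas Z_density BQ
  (l0 a aI) (u1 a aI) (la a aI) (au a aI).
have Psi_left (a : R) aI := Psi_cvg_left bijS Lambda_inv Z_ge0 Z_meas Z_density BQ
  (l0 a aI) (u1 a aI) (la a aI) (au a aI).
have Xi_e_right (a : R) aI := Xi_eps_cvg_right bijS Lambda_inv Z_ge0 Z_meas Z_density BQ
  (l0 a aI) (u1 a aI) (la a aI) (au a aI).
have Xi_right (a : R) aI := Xi_cvg_right bijS Lambda_inv Z_ge0 Z_meas Z_density BQ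
  (l0 a aI) (u1 a aI) (la a aI) (au a aI).
have Xi_eps'_right (a : R) aI := Xi_eps'_cvg_right bijS Lambda_inv Z_ge0 Z_meas Z_density BQ
  (l0 a aI) (u1 a aI) (la a aI) (au a aI).
split=> [a aI|a tau aI tau1|a tau aI tau0|a tau aI tau1].
- by eexists; exact: quotient aI.
- rewrite /Hb (derivative _ aI); split; first by rewrite /Xi1 (XiE _ aI).
  split; split.
  + exact: Xi_left aI _ (c_a a).
  + exact: Xi_left aI _ (c_id a).
  + exact: Psi_e_left aI _ (c_a a) _ tau1.
  + exact: Psi_e_left aI _ (c_id a) _ tau1.
  + exact: Psi_left aI _ (c_a a).
  + exact: Psi_left aI _ (c_id a).
- rewrite /Xi1 (XiE _ aI); split.
  + by apply: (Xi_eps'_right _ aI _ (c_id a) _ tau0) => b; exact: ltW.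
  + by apply: (Xi_eps'_right _ aI _ (c_a a) _ tau0).
- rewrite /Psi1 (PsiE _ aI); split.
  + exact: Xi_e_right aI _ (c_id a) _ tau1.
  + exact: Xi_e_right aI _ (c_a a) _ tau1.
  + exact: Xi_right aI _ (c_id a).
  + exact: Xi_right aI _ (c_a a).
Qed.
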